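(* Let $D$ be a $2$-dimensional regular local ring. The set of patch limit points of $Q(D)$ in $L(D)$ is precisely the set of valuation rings in $L(D)$. Consequently the patch closure of $Q(D)$ in $L(D)$ is $Q^*(D)$.
   Context: $F$ is the quotient field of $D$. $L(D)$ is the set of local rings $R$ with $D\subseteq R\subseteq F$ and $\mathfrak{m}_R\cap D=\mathfrak{m}_D$. For $x_1,\dots,x_n\in F$, $\mathcal{U}(x_1,\dots,x_n)=\{R\in L(D):x_1,\dots,x_n\in R\}$ and $\mathcal{V}(x_1,\dots,x_n)=L(D)\setminus\mathcal{U}(x_1,\dots,x_n)$. The patch topology on $L(D)$ is the topology generated by all sets $\mathcal{U}(x_1,\dots,x_n)$ and $\mathcal{V}(x_1,\dots,x_n)$. $Q(D)$ is the set of $2$-dimensional regular local rings $\alpha$ with $D\subseteq\alpha\subseteq F$, and $Q^*(D)$ is the union of $Q(D)$ and all valuation rings in $L(D)$. *)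

(* Defs.v *)
(* Subrings of a field F are represented as predicates F -> Prop. *)
From mathcomp Require Import all_boot all_order all_algebra.
Set Implicit Arguments. Unset Strict Implicit. Unset Printing Implicit Defensive.
Import GRing.Theory.
Local Open Scope ring_scope.

Section Defs.
Variable F : fieldType.
Implicit Types (R D I P A : F -> Prop).

Definition is_subring R : Prop :=
  R 0 /\ R 1 /\ (forall x y, R x -> R y -> R (x + y)) /\
  (forall x, R x -> R (- x)) /\ (forall x y, R x -> R y -> R (x * y)).

Definition subsetP A B : Prop := forall x, A x -> B x.
Definition strict_subset A B : Prop := subsetP A B /\ ~ subsetP B A.

Definition is_ideal R I : Prop :=
  subsetP I R /\ I 0 /\ (forall x y, I x -> I y -> I (x + y)) /\
  (forall r x, R r -> I x -> I (r * x)).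

Definition is_prime_ideal R P : Prop :=
  is_ideal R P /\ ~ P 1 /\
  (forall x y, R x -> R y -> P (x * y) -> P x \/ P y).

Definition generated_by R I (s : seq F) : Prop :=
  (forall g, g \in s -> I g) /\
  forall x, I x -> exists r : seq F, size r = size s /\
    (forall c, c \in r -> R c) /\ x = \sum_(i < size s) r`_i * s`_i.

Definition noetherian R : Prop :=
  forall I, is_ideal R I -> exists s, generated_by R I s.

Definition prime_chain R n : Prop :=
  exists P : nat -> F -> Prop,
    (forall i, (i <= n)%N -> is_prime_ideal R (P i)) /\
    (forall i, (i < n)%N -> strict_subset (P i) (P i.+1)).

Definition krull_dim_eq R (n : nat) : Prop := prime_chain R n /\ ~ prime_chain R n.+1.

Definition nonunits R : F -> Prop :=
  fun x => R x /\ ~ (exists y, R y /\ x * y = 1).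

(* R is local: its non-units form an ideal (which is then the unique
   maximal ideal m_R = nonunits R) *)
Definition is_local R : Prop := is_subring R /\ is_ideal R (nonunits R).

Definition regular_local_dim2 R : Prop :=
  is_local R /\ noetherian R /\ krull_dim_eq R 2 /\
  exists a b, generated_by R (nonunits R) [:: a; b].

Definition is_quotient_field D : Prop :=
  forall x, exists a b, D a /\ D b /\ b != 0 /\ x = a / b.

Definition is_valuation_ring R : Prop :=
  is_subring R /\ forall x, x != 0 -> R x \/ R x^-1.

Definition LD D R : Prop :=
  is_local R /\ subsetP D R /\
  forall x, D x -> (nonunits R x <-> nonunits D x).

Definition QD D R : Prop := regular_local_dim2 R /\ subsetP D R.

Definition QstarD D R : Prop := QD D R \/ (LD D R /\ is_valuation_ring R).

Definition Uset D (s : seq F) (R : F -> Prop) : Prop :=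
  LD D R /\ forall x, x \in s -> R x.
Definition Vset D (s : seq F) (R : F -> Prop) : Prop :=
  LD D R /\ ~ Uset D s R.

Definition patch_subbasic D (W : (F -> Prop) -> Prop) : Prop :=
  exists s, (forall R, W R <-> Uset D s R) \/ (forall R, W R <-> Vset D s R).

Definition same_ring R R' : Prop := forall x, R x <-> R' x.

(* R is a patch limit point of S in L(D): every basic open neighbourhood
   (finite intersection of subbasic sets) of R meets S in a point other than R *)
Definition patch_limit_point D (S : (F -> Prop) -> Prop) R : Prop :=
  LD D R /\
  forall (n : nat) (W : nat -> (F -> Prop) -> Prop),
    (forall i, (i < n)%N -> patch_subbasic D (W i)) ->
    (forall i, (i < n)%N -> W i R) ->
    exists R', S R' /\ LD D R' /\ ~ same_ring R' R /\ forall i, (i < n)%N -> W i R'.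

Definition patch_closure D (S : (F -> Prop) -> Prop) R : Prop :=
  LD D R /\
  forall (n : nat) (W : nat -> (F -> Prop) -> Prop),
    (forall i, (i < n)%N -> patch_subbasic D (W i)) ->
    (forall i, (i < n)%N -> W i R) ->
    exists R', S R' /\ LD D R' /\ forall i, (i < n)%N -> W i R'.

End Defs.

(* Main.v *)
(* The engine is Abhyankar's theorem that an infinite sequence of local quadratic transforms
   of a 2-dimensional regular local ring has a valuation ring as its union.

   If V is a valuation ring dominating D, follow the quadratic transforms of D along V.
   Either the sequence is infinite, and then its union is V, so finitely many elements of V
   lie in one of its members; or some member D' has V as its order valuation ring, and then
   finitely many elements of V lie in all but finitely many quadratic transforms of D'.  In
   both cases every patch neighbourhood of V contains a regular ring inside V.

   Conversely let R be a limit point of Q(D).  Any ring in Q(D) other than D contains y/x or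
   x/y for parameters x, y of D, hence so does R, and R contains the order valuation ring of
   D or dominates a unique quadratic transform D' of D.  The latter condition is patch open,
   so R is a limit point of Q(D').  Iterating, R contains a valuation ring. *)
Require Import Defs.
From mathcomp Require Import all_boot all_order all_algebra.
From mathcomp Require Import ring.
From Stdlib Require Import Classical ClassicalEpsilon.
From Stdlib Require Import FunctionalExtensionality PropExtensionality.
Set Implicit Arguments. Unset Strict Implicit. Unset Printing Implicit Defensive.
Import GRing.Theory.
Local Open Scope ring_scope.

(* [subsetP] alone would denote the lemma of [fintype]. *)
Notation incl := Defs.subsetP.

(** Dimension theory is reduced to one fact: neither parameter divides a power of the other ([reg]).
    With Nakayama this yields all that is used of regularity: [x] is prime, ideals saturated by [x]
    are principal, every fraction can be written with numerator and denominator generating an ideal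
    that contains powers of both parameters (a substitute for unique factorization), and the ring is
    normal. Finite length appears only as a descending chain condition.

    The recurring device is an element [z] such that neither [z] nor its inverse lies in a given
    normal local ring. Such a [z] is residually transcendental, so it behaves like a variable modulo
    the maximal ideal, and Gauss's lemma applies to polynomials in it. With [z = y/x] this produces
    the order valuation ring. In Abhyankar's theorem it is applied to a supposed counterexample [z],
    over the union of the whole sequence. *)

Lemma ex_minimal (P : nat -> Prop) :
  (exists n, P n) -> exists2 n, P n & forall k, P k -> (n <= k)%N.
Proof.
move=> [n]; elim/ltn_ind: n => n IH Pn.
case: (classic (exists2 k, P k & (k < n)%N)) => [[k Pk lt_kn]|nex]; first exact: IH Pk.
exists n => // k Pk; rewrite leqNgt; apply/negP => lt_kn; apply: nex; by exists k.
Qed.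

Lemma dependent_choice (T : Type) (Q : T -> Prop) (E : T -> T -> Prop) (a : T) :
  Q a -> (forall u, Q u -> exists2 v, Q v & E u v) ->
  exists f : nat -> T, [/\ f 0%N = a, forall n, Q (f n) & forall n, E (f n) (f n.+1)].
Proof.
move=> Qa step.
have nxt u : exists v, Q u -> Q v /\ E u v.
  case: (classic (Q u)) => [/step [v Qv Euv]|nQ]; first by exists v.
  by exists u.
pose g u := proj1_sig (constructive_indefinite_description _ (nxt u)).
have gP u : Q u -> Q (g u) /\ E u (g u).
  exact: (proj2_sig (constructive_indefinite_description _ (nxt u))).
have Qf n : Q (iter n g a) by elim: n => //= n /gP [].
by exists (fun n => iter n g a); split => // n; have [] := gP _ (Qf n).
Qed.

(** Recursive form of the indexed sum in [generated_by]. The ambient ring is arbitrary because the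
    same notion is needed in [F] and, for the Hilbert basis argument, in [{poly F}]. *)
Fixpoint span (T : comNzRingType) (R : T -> Prop) (s : seq T) (z : T) : Prop :=
  if s is g :: s' then exists r y, [/\ R r, span R s' y & z = r * g + y] else z = 0.

(** * Subrings and ideals of a field *)

Section Rings.
Variable F : fieldType.
Implicit Types (R D I J K L M P A S : F -> Prop) (a b c d x y z t u v w : F).

Lemma sr0 R : is_subring R -> R 0. Proof. by case. Qed.
Lemma sr1 R : is_subring R -> R 1. Proof. by case=> _ []. Qed.
Lemma srD R : is_subring R -> forall x y, R x -> R y -> R (x + y).
Proof. by case=> _ [_ []]. Qed.
Lemma srN R : is_subring R -> forall x, R x -> R (- x).
Proof. by case=> _ [_ [_ []]]. Qed.
Lemma srM R : is_subring R -> forall x y, R x -> R y -> R (x * y).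
Proof. by case=> _ [_ [_ []]]. Qed.
Lemma srX R : is_subring R -> forall x n, R x -> R (x ^+ n).
Proof.
move=> hR x n Rx; elim: n => [|n IH]; first by rewrite expr0; apply: sr1.
by rewrite exprS; apply: srM.
Qed.

Lemma srMn R : is_subring R -> forall x n, R x -> R (x *+ n).
Proof.
move=> hR x n Rx; elim: n => [|n IH]; first by rewrite mulr0n; apply: sr0.
by rewrite mulrS; apply: srD.
Qed.

Lemma not_incl I J : ~ incl I J -> exists2 z, I z & ~ J z.
Proof.
move=> nIJ; apply: NNPP => nex; apply: nIJ => z Iz.
by apply: NNPP => nJz; apply: nex; exists z.
Qed.

Lemma id_sub R I : is_ideal R I -> forall x, I x -> R x. Proof. by case. Qed.
Lemma id0 R I : is_ideal R I -> I 0. Proof. by case=> _ []. Qed.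
Lemma idD R I : is_ideal R I -> forall x y, I x -> I y -> I (x + y).
Proof. by case=> _ [_ []]. Qed.
Lemma idM R I : is_ideal R I -> forall r x, R r -> I x -> I (r * x).
Proof. by case=> _ [_ []]. Qed.
Lemma idMr R I : is_ideal R I -> forall r x, R r -> I x -> I (x * r).
Proof. by move=> h r x Rr Ix; rewrite mulrC; apply: (idM h). Qed.
Lemma idN R I : is_subring R -> is_ideal R I -> forall x, I x -> I (- x).
Proof.
move=> hR hI x Ix; rewrite -mulN1r; apply: (idM hI) => //.
by apply: (srN hR); apply: sr1.
Qed.
Lemma idB R I : is_subring R -> is_ideal R I -> forall x y, I x -> I y -> I (x - y).
Proof. by move=> hR hI x y Ix Iy; apply: (idD hI) => //; apply: (idN hR hI). Qed.

End Rings.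

Ltac rin := repeat first
  [ assumption
  | match goal with
    | h : is_subring ?R |- ?R (_ + _) => apply: (srD h)
    | h : is_subring ?R |- ?R (_ * _) => apply: (srM h)
    | h : is_subring ?R |- ?R (- _) => apply: (srN h)
    | h : is_subring ?R |- ?R (_ ^+ _) => apply: (srX h)
    | h : is_subring ?R |- ?R (_ *+ _) => apply: (srMn h)
    | h : is_subring ?R |- ?R 1 => exact: (sr1 h)
    | h : is_subring ?R |- ?R 0 => exact: (sr0 h)
    end ].

(** * Local rings, Nakayama's lemma and Krull's intersection theorem *)

Section LocalRings.
Variable F : fieldType.
Implicit Types (R D I J K L M P A S : F -> Prop) (a b c d x y z t u v w : F).

Lemma span_sumP R (s : seq F) z :
  span R s z <-> exists r : seq F, size r = size s /\
    (forall c, c \in r -> R c) /\ z = \sum_(i < size s) r`_i * s`_i.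
Proof.
elim: s z => [|g s IH] z /=.
  split=> [->|[r [_ [_ ->]]]]; last by rewrite big_ord0.
  by exists [::]; rewrite big_ord0.
split=> [[r [y [Rr /IH [q [sq [Rq ->]]] ->]]]|[[|r q] [//= [sq] [Rq ->]]]].
  exists (r :: q); split; first by rewrite /= sq.
  split; last by rewrite big_ord_recl.
  by move=> c; rewrite inE => /orP [/eqP ->|/Rq].
rewrite big_ord_recl /=; exists r, (\sum_(i < size s) q`_i * s`_i); split => //.
  by apply: Rq; rewrite inE eqxx.
by apply/IH; exists q; split => //; split => // c cq; apply: Rq; rewrite inE cq orbT.
Qed.

Lemma generated_spanP R I (s : seq F) :
  generated_by R I s <-> (forall g, g \in s -> I g) /\ (forall z, I z -> span R s z).
Proof. by split=> -[h1 h2]; split=> // z /h2 /span_sumP. Qed.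

Lemma span_ideal R I (s : seq F) z :
  is_ideal R I -> (forall g, g \in s -> I g) -> span R s z -> I z.
Proof.
move=> hI; elim: s z => [|g s IH] z hs /=; first by move->; apply: (id0 hI).
move=> [r [y [Rr sy ->]]]; apply: (idD hI).
  by apply: (idM hI) => //; apply: hs; rewrite inE eqxx.
by apply: IH sy => h hin; apply: hs; rewrite inE hin orbT.
Qed.

Lemma noetherian_acc R (I : nat -> F -> Prop) : noetherian R ->
  (forall n, is_ideal R (I n)) -> (forall n, incl (I n) (I n.+1)) ->
  exists n, forall m, incl (I m) (I n).
Proof.
move=> noeth hI inc.
have mono m n : (m <= n)%N -> incl (I m) (I n).
  move=> /subnK <-; elim: (n - m)%N => [|k IH] z Iz //.
  by rewrite addSn; apply/inc/IH.
have hU : is_ideal R (fun z => exists n, I n z).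
  split; first by move=> z [n /(id_sub (hI n))].
  split; first by exists 0%N; apply: (id0 (hI 0%N)).
  split; last by move=> r z Rr [n Iz]; exists n; apply: (idM (hI n)).
  move=> z z' [n Iz] [n' Iz']; exists (maxn n n').
  by apply: (idD (hI _)); [apply: mono Iz; rewrite leq_maxl|apply: mono Iz'; rewrite leq_maxr].
have [s /generated_spanP [sU Us]] := noeth _ hU.
have [N hN] : exists N, forall g, g \in s -> I N g.
  elim: s sU {Us} => [|g s IH] sU; first by exists 0%N.
  have [|N hN] := IH; first by move=> h hin; apply: sU; rewrite inE hin orbT.
  have [|n hn] := sU g; first by rewrite inE eqxx.
  exists (maxn n N) => h; rewrite inE => /orP [/eqP ->|/hN].
    by apply: mono hn; rewrite leq_maxl.
  by apply: mono; rewrite leq_maxr.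
exists N => m z Iz; apply: (span_ideal (hI N) hN); apply: Us; by exists m.
Qed.

Lemma local_sub R : is_local R -> is_subring R. Proof. by case. Qed.
Lemma local_id R : is_local R -> is_ideal R (nonunits R). Proof. by case. Qed.

Lemma nonunits_sub R x : nonunits R x -> R x. Proof. by case. Qed.

Lemma unit_inv R x : R x -> ~ nonunits R x -> x != 0 /\ R x^-1.
Proof.
move=> Rx nu; have [y [Ry xy]] : exists y, R y /\ x * y = 1.
  by apply: NNPP => h; apply: nu.
have x0 : x != 0.
  by apply/eqP => x0; move: xy; rewrite x0 mul0r => /esym/eqP; rewrite oner_eq0.
by split=> //; rewrite -[x^-1]mulr1 -xy mulKf.
Qed.

Lemma nonunitsN1 R x y : nonunits R x -> R y -> x * y <> 1.
Proof. by move=> [_ h] Ry e; apply: h; exists y. Qed.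

Lemma nonunits_inv R x : x != 0 -> R x^-1 -> ~ nonunits R x.
Proof. by move=> x0 Rx; move/nonunitsN1 => /(_ _ Rx); rewrite divff. Qed.

Lemma nonunits1 R : is_subring R -> ~ nonunits R 1.
Proof. by move=> hR; apply: nonunits_inv; rewrite ?oner_eq0 ?invr1 //; apply: sr1. Qed.

Lemma nonunits_mul R x y : is_local R -> R x -> R y ->
  nonunits R (x * y) -> nonunits R x \/ nonunits R y.
Proof.
move=> hR Rx Ry nxy; apply: NNPP => /not_or_and [/(unit_inv Rx) [x0 Rx'] /(unit_inv Ry) [y0 Ry']].
have hs := local_sub hR.
apply: nonunits_inv nxy; first by rewrite mulf_neq0.
by rewrite invfM; rin.
Qed.

Lemma nonunits_prime R : is_local R -> is_prime_ideal R (nonunits R).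
Proof.
move=> hR; split; first exact: local_id.
split; first exact/nonunits1/local_sub.
by move=> x y; apply: nonunits_mul.
Qed.

Lemma proper_sub_nonunits R I x : is_ideal R I -> ~ I 1 -> I x -> nonunits R x.
Proof.
move=> hI I1 Ix; split; first exact: (id_sub hI).
by move=> [y [Ry xy]]; apply: I1; rewrite -xy; apply: (idMr hI).
Qed.

Lemma prime_exp R P x n : is_prime_ideal R P -> is_subring R -> R x -> P (x ^+ n) -> P x.
Proof.
move=> [hI [P1 hP]] hR Rx; elim: n => [|n IH]; first by [].
by rewrite exprS => /hP []; rin.
Qed.

Definition dvdr R x a : Prop := exists2 c, R c & a = c * x.

Lemma dvdr_ideal R x : is_subring R -> R x -> is_ideal R (dvdr R x).
Proof.
move=> hR Rx; split; first by move=> _ [c Rc ->]; rin.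
split; first by exists 0; rewrite ?mul0r //; apply: sr0.
split; first by move=> _ _ [c Rc ->] [d Rd ->]; exists (c + d); rewrite ?mulrDl //; rin.
by move=> r _ Rr [c Rc ->]; exists (r * c); rewrite ?mulrA //; rin.
Qed.

Lemma dvdr_refl R x : is_subring R -> dvdr R x x.
Proof. by move=> hR; exists 1; rewrite ?mul1r //; rin. Qed.

Definition sumI J K z : Prop := exists x y, [/\ J x, K y & z = x + y].

Lemma sumI_ideal R J K : is_ideal R J -> is_ideal R K -> is_subring R ->
  is_ideal R (sumI J K).
Proof.
move=> hJ hK hR; split; first by move=> _ [x [y [/(id_sub hJ) ? /(id_sub hK) ? ->]]]; rin.
split; first by exists 0, 0; rewrite addr0; split => //; [exact: (id0 hJ)|exact: (id0 hK)].
split.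
  move=> _ _ [x [y [Jx Ky ->]]] [x' [y' [Jx' Ky' ->]]]; exists (x + x'), (y + y').
  by split; [exact: (idD hJ)|exact: (idD hK)|ring].
move=> r _ Rr [x [y [Jx Ky ->]]]; exists (r * x), (r * y).
by split; [exact: (idM hJ)|exact: (idM hK)|ring].
Qed.

Lemma sumI_l R J K x : is_ideal R K -> J x -> sumI J K x.
Proof. by move=> hK Jx; exists x, 0; rewrite addr0; split => //; apply: (id0 hK). Qed.

Lemma sumI_r R J K x : is_ideal R J -> K x -> sumI J K x.
Proof. by move=> hJ Kx; exists 0, x; rewrite add0r; split => //; apply: (id0 hJ). Qed.

(* [M] need not be an ideal: if [a_n = j_n + x a_(n+1)] with all [a_n] in [M],
   the ideals [J + R a_n] increase, so [a_(n+1)] lies in [J + x R a_(n+1)] for some [n]. *)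
Lemma nakayama R J M x : is_local R -> noetherian R -> is_ideal R J -> nonunits R x ->
  incl M R -> (forall a, M a -> exists2 a', M a' & J (a - x * a')) -> incl M J.
Proof.
move=> hl noeth hJ nx MR step a Ma; have hR := local_sub hl.
have [f [f0 Mf Ef]] := dependent_choice Ma step.
have Rx := nonunits_sub nx.
have Rf n : R (f n) by apply: MR.
have hI n : is_ideal R (sumI J (dvdr R (f n))).
  by apply: sumI_ideal => //; apply: dvdr_ideal.
have [n|n hn] := noetherian_acc noeth hI.
  move=> _ [j [_ [Jj [c Rc ->] ->]]].
  exists (j + c * (f n - x * f n.+1)), (c * x * f n.+1); split; last by ring.
    by apply: (idD hJ) => //; apply: (idM hJ).
  by exists (c * x); rin.
have Jn : J (f n.+1).
  have [|j [_ [Jj [c Rc ->] e]]] := hn n.+1 (f n.+1).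
    by apply: (sumI_r hJ); apply: dvdr_refl.
  have e' : (1 - c * x) * f n.+1 = j + c * (f n - x * f n.+1).
    by rewrite mulrBl mul1r {1}e; ring.
  have R1 : R (1 - c * x) by rin.
  have nu : ~ nonunits R (1 - c * x).
    move=> h; apply: (nonunits1 hR).
    have -> : 1 = (1 - c * x) + c * x :> F by ring.
    by apply: (idD (local_id hl)) => //; apply: (idM (local_id hl)).
  have [u0 Ru] := unit_inv R1 nu.
  have -> : f n.+1 = (1 - c * x)^-1 * (j + c * (f n - x * f n.+1)) by rewrite -e' mulKf.
  by apply: (idM hJ) => //; apply: (idD hJ) => //; apply: (idM hJ).
rewrite -f0; have : forall k, J (f k.+1) -> J (f k).
  move=> k Jk; have -> : f k = (f k - x * f k.+1) + x * f k.+1 by ring.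
  by apply: (idD hJ) => //; apply: (idM hJ).
by move=> h; elim: (n.+1) Jn => // k IH /h.
Qed.

(** An element without such a factorization is a multiple of [x], and the cofactor has no such
    factorization either. So the set of these elements satisfies the hypothesis of [nakayama] with
    the zero ideal, and contains at most 0. *)
Lemma krull_intersection R x a : is_local R -> noetherian R -> nonunits R x -> R a ->
  a != 0 -> exists i b, [/\ R b, ~ dvdr R x b & a = x ^+ i * b].
Proof.
move=> hl noeth nx Ra a0; have hR := local_sub hl; apply: NNPP => hno.
have hJ : is_ideal R (fun z => z = 0).
  split; first by move=> _ ->; rin.
  by split=> //; split=> [_ _ -> ->|r _ _ ->]; rewrite ?addr0 ?mulr0.
pose M a := R a /\ ~ exists i b, [/\ R b, ~ dvdr R x b & a = x ^+ i * b].
have Ma : M a by [].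
case/eqP: a0; move: a Ma {Ra hno}; apply: (nakayama hl noeth hJ nx); first by move=> a [].
move=> a [Ra hno].
have [c Rc e] : dvdr R x a.
  apply: NNPP => nd; apply: hno; exists 0%N, a; by rewrite expr0 mul1r.
exists c; last by rewrite e; ring.
split=> // -[i [b [Rb nb eb]]]; apply: hno; exists i.+1, b; split => //.
by rewrite e eb exprS; ring.
Qed.

End LocalRings.

(** * Finite length, and the structure of two-dimensional regular local rings *)

Section Chains.
Variable F : fieldType.
Implicit Types (R D I J L M P A S : F -> Prop) (a b c d g x y z t u v w : F).

Definition stabilizes (K : nat -> F -> Prop) : Prop :=
  exists n, forall m, (n <= m)%N -> incl (K n) (K m).

(** Plays the part of finite length of [M/L]. Only descending chains are recorded, since ascending
    ones are controlled by [noetherian]. *)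
Definition dcc R M L : Prop := forall K : nat -> F -> Prop,
  (forall n, is_ideal R (K n)) -> (forall n, incl (K n.+1) (K n)) ->
  (forall n, incl L (K n)) -> (forall n, incl (K n) M) -> stabilizes K.

Lemma decreasing_le (K : nat -> F -> Prop) : (forall n, incl (K n.+1) (K n)) ->
  forall m n, (m <= n)%N -> incl (K n) (K m).
Proof.
move=> dec m n /subnK <-; elim: (n - m)%N => [|k IH] z Kz //.
by apply: IH; apply: dec; rewrite -addSn.
Qed.

Lemma dcc_mono R M M' L : incl M M' -> dcc R M' L -> dcc R M L.
Proof. by move=> MM' h K hK dec LK KM; apply: h => // n z /KM /MM'. Qed.

(** Modular law: nested ideals with the same sum with [M'] and the same intersection with [M']
    coincide. *)
Lemma dcc_trans R M M' L : is_subring R -> is_ideal R M' -> incl L M' -> incl M' M ->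
  (forall x y, M x -> M y -> M (x + y)) ->
  dcc R M M' -> dcc R M' L -> dcc R M L.
Proof.
move=> hR hM' LM' M'M MD d1 d2 K hK dec LK KM.
have le := decreasing_le dec.
have [||||n1 h1] := d1 (fun n => sumI (K n) M').
- by move=> n; apply: sumI_ideal.
- by move=> n _ [u [v [/dec Ku Mv ->]]]; exists u, v.
- by move=> n z; apply: (sumI_r (hK n)).
- by move=> n _ [u [v [/KM Ku /M'M Mv ->]]]; apply: MD.
have [||||n2 h2] := d2 (fun n z => K n z /\ M' z).
- move=> n; split; first by move=> z [/(id_sub (hK n))].
  split; first by split; [apply: (id0 (hK n))|apply: (id0 hM')].
  split=> [u v [Ku Mu] [Kv Mv]|r u Rr [Ku Mu]].
    by split; [apply: (idD (hK n))|apply: (idD hM')].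
  by split; [apply: (idM (hK n))|apply: (idM hM')].
- by move=> n z [/dec].
- by move=> n z Lz; split; [apply: LK|apply: LM'].
- by move=> n z [].
exists (maxn n1 n2) => m lem z Kz.
have [le1 le2] : (n1 <= m)%N /\ (n2 <= m)%N.
  by split; apply: leq_trans lem; rewrite ?leq_maxl ?leq_maxr.
have [|k [v [Kk Mv e]]] := h1 m le1 z.
  by apply: (sumI_l hM'); apply: le Kz; rewrite leq_maxl.
rewrite e; apply: (idD (hK m)) => //.
have [] // := h2 m le2 v.
split=> //; have -> : v = z - k by rewrite e; ring.
apply: (idB hR (hK _)); first by apply: le Kz; rewrite leq_maxr.
exact: le Kk.
Qed.

(** The quotient of [L + Rg] by [L] is a quotient of the residue field, so an ideal in between
    either lies in [L] or contains [g]. *)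
Lemma dcc_step R L g : is_local R -> is_ideal R L -> R g ->
  (forall r, nonunits R r -> L (r * g)) -> dcc R (sumI L (dvdr R g)) L.
Proof.
move=> hl hL Rg hg K hK dec LK KM; have hR := local_sub hl.
case: (classic (exists n, incl (K n) L)) => [[n KL]|nK].
  by exists n => m _ z /KL /LK.
have Kg n : K n g.
  apply: NNPP => nKg; apply: nK; exists n => z Kz.
  have [l [_ [Ll [r Rr ->] e]]] := KM n z Kz.
  case: (classic (nonunits R r)) => [/hg Lr|/(unit_inv Rr) [r0 Ri]].
    by rewrite e; apply: (idD hL).
  case: nKg; have -> : g = r^-1 * (z - l) by rewrite e addrAC subrr add0r mulKf.
  by apply: (idM (hK n)) => //; apply: (idB hR (hK n)) => //; apply: LK.
exists 0%N => m _ z /KM [l [_ [Ll [r Rr ->] ->]]].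
by apply: (idD (hK m)); [apply: LK|apply: (idM (hK m))].
Qed.

Definition maxgen R x y : Prop :=
  forall z, nonunits R z <-> exists r s, [/\ R r, R s & z = r * x + s * y].

Lemma maxgenl R x y : is_subring R -> maxgen R x y -> nonunits R x.
Proof. by move=> hR hm; apply/hm; exists 1, 0; split; rin; ring. Qed.

Lemma maxgenr R x y : is_subring R -> maxgen R x y -> nonunits R y.
Proof. by move=> hR hm; apply/hm; exists 0, 1; split; rin; ring. Qed.

Lemma maxgenC R x y : maxgen R x y -> maxgen R y x.
Proof.
move=> hm z; split=> [/hm [r [s [Rr Rs ->]]]|[r [s [Rr Rs ->]]]].
  by exists s, r; split=> //; ring.
by apply/hm; exists s, r; split=> //; ring.
Qed.

(** Filter by [L], [L + (yg)], [L + (yg, xg)], and finally add [g]. The first two layers have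
    generators killed by monomials of degree one less, so induction on [j] applies; the last is
    killed by the maximal ideal. *)
Lemma dcc_gen R x y j L g : is_local R -> maxgen R x y -> is_ideal R L -> R g ->
  (forall i k, (i + k)%N = j -> L (x ^+ i * y ^+ k * g)) ->
  dcc R (sumI L (dvdr R g)) L.
Proof.
move=> hl hm; have hR := local_sub hl.
have Rx := nonunits_sub (maxgenl hR hm); have Ry := nonunits_sub (maxgenr hR hm).
elim: j L g => [|j IH] L g hL Rg hg.
  apply: (@dcc_mono _ _ L); last by move=> K hK dec LK KM; exists 0%N => m _ z /KM /LK.
  move=> _ [l [_ [Ll [r Rr ->] ->]]]; apply: (idD hL) => //; apply: (idM hL) => //.
  by have := hg 0%N 0%N erefl; rewrite !expr0 !mul1r.
have hI1 : is_ideal R (dvdr R (y * g)) by apply: dvdr_ideal; rin.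
have hI2 : is_ideal R (dvdr R (x * g)) by apply: dvdr_ideal; rin.
have hI3 : is_ideal R (dvdr R g) by apply: dvdr_ideal; rin.
pose L1 := sumI L (dvdr R (y * g)); pose L2 := sumI L1 (dvdr R (x * g)).
have hL1 : is_ideal R L1 by apply: sumI_ideal.
have hL2 : is_ideal R L2 by apply: sumI_ideal.
have hM : is_ideal R (sumI L2 (dvdr R g)) by apply: sumI_ideal.
have LL1 : incl L L1 by move=> z; apply: sumI_l hI1.
have L12 : incl L1 L2 by move=> z; apply: sumI_l hI2.
have d1 : dcc R L1 L.
  apply: IH => //; first by rin.
  move=> i k e; have := hg i k.+1; rewrite addnS e => /(_ erefl).
  by rewrite exprSr !mulrA.
have d2 : dcc R L2 L1.
  apply: IH => //; first by rin.
  move=> i k e; have := hg i.+1 k; rewrite addSn e => /(_ erefl) h.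
  by apply: LL1; move: h; congr L; rewrite exprSr; ring.
have d3 : dcc R (sumI L2 (dvdr R g)) L2.
  apply: dcc_step => // r /hm [p [q [Rp Rq ->]]].
  rewrite mulrDl; apply: (idD hL2).
    by apply: (sumI_r hL1); exists p; rewrite ?mulrA.
  by apply: L12; apply: (sumI_r hL); exists q; rewrite ?mulrA.
have d4 : dcc R L2 L.
  by apply: dcc_trans d2 d1 => //; apply: (idD hL2).
apply: (@dcc_mono _ _ (sumI L2 (dvdr R g))).
  by move=> _ [l [w [Ll Iw ->]]]; exists l, w; split=> //; apply/L12/LL1.
apply: dcc_trans d3 d4 => //.
- by move=> z /LL1 /L12.
- by move=> z; apply: sumI_l hI3.
- exact: (idD hM).
Qed.

Lemma dcc_mod R x y j L : is_local R -> maxgen R x y -> is_ideal R L ->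
  (forall i k, (i + k)%N = j -> L (x ^+ i * y ^+ k)) -> dcc R R L.
Proof.
move=> hl hm hL hg; have hR := local_sub hl.
apply: (@dcc_mono _ _ (sumI L (dvdr R 1))).
  by move=> z Rz; apply: (sumI_r hL); exists z; rewrite ?mulr1.
apply: (dcc_gen (j := j) hl hm hL); first by rin.
by move=> i k e; rewrite mulr1; apply: hg e.
Qed.

(* With [J_k = (p^k R : b^oo)], the chain condition modulo [b] gives
   [J_k = J_(k+1) + b J_k] for some [k], whence [p^k] lies in [J_(k+1)]. *)
Lemma power_dvd R b p : is_local R -> noetherian R -> nonunits R b ->
  dcc R R (dvdr R b) -> R p -> p != 0 -> exists N, dvdr R p (b ^+ N).
Proof.
move=> hl noeth nb hd Rp p0; have hR := local_sub hl; have Rb := nonunits_sub nb.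
pose J k d := R d /\ exists N, dvdr R (p ^+ k) (b ^+ N * d).
have hJ k : is_ideal R (J k).
  split; first by move=> z [].
  split; first by split; rin; exists 0%N; exists 0; rin; ring.
  split=> [z z' [Rz [N [c Rc e]]] [Rz' [N' [c' Rc' e']]]|r z Rr [Rz [N [c Rc e]]]].
    split; rin; exists (N + N')%N; exists (b ^+ N' * c + b ^+ N * c'); rin.
    rewrite exprD; transitivity (b ^+ N' * (b ^+ N * z) + b ^+ N * (b ^+ N' * z')); first by ring.
    by rewrite e e'; ring.
  by split; rin; exists N; exists (r * c); rin; rewrite mulrCA e mulrA.
have Jdec k : incl (J k.+1) (J k).
  move=> z [Rz [N [c Rc e]]]; split=> //; exists N; exists (c * p); rin.
  by rewrite e exprS mulrA.
have hb : is_ideal R (dvdr R b) by apply: dvdr_ideal.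
have [||||n hn] := hd (fun k => sumI (J k) (dvdr R b)).
- by move=> n; apply: sumI_ideal.
- by move=> n _ [u [v [/Jdec Ku Mv ->]]]; exists u, v.
- by move=> n z Mz; exact: (sumI_r (hJ n) Mz).
- by move=> n _ [u [v [[Ru _] [c Rc ->] ->]]]; rin.
have JJ : incl (J n) (J n.+1).
  apply: (nakayama hl noeth (hJ n.+1) nb); first by move=> z [].
  move=> a Ja; have [|a1 [_ [Ja1 [d Rd ->] e]]] := hn n.+1 (leqnSn n) a.
    exact: (sumI_l hb Ja).
  exists d; last by rewrite e; have -> : a1 + d * b - b * d = a1 by ring.
  have [_ [N [c Rc ec]]] : J n (d * b).
    have -> : d * b = a - a1 by rewrite e; ring.
    by apply: (idB hR (hJ n)) => //; apply: Jdec.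
  split=> //; exists N.+1; exists c => //; by rewrite -ec exprS; ring.
have [_ [N [c Rc e]]] : J n.+1 (p ^+ n).
  by apply: JJ; split; rin; exists 0%N; rewrite expr0 mul1r; apply: dvdr_refl.
exists N; exists c => //; apply: (mulIf (expf_neq0 n p0)).
by rewrite e exprS mulrA.
Qed.

(** A case of Krull's principal ideal theorem. Monomials of degree [n] lie in [xR], so [R/xR] has
    finite length and every nonzero element divides a power of [x]. A nonzero prime thus contains
    [x], then [y], and is maximal. *)
Lemma no_chain2 R x y n : is_local R -> noetherian R -> maxgen R x y ->
  dvdr R x (y ^+ n) -> ~ prime_chain R 2.
Proof.
move=> hl noeth hm hy [P [hP hs]]; have hR := local_sub hl.
have nx := maxgenl hR hm; have Rx := nonunits_sub nx.
have ny := maxgenr hR hm; have Ry := nonunits_sub ny.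
have hd : dcc R R (dvdr R x).
  apply: (dcc_mod (j := n) hl hm); first exact: dvdr_ideal.
  move=> [|i] k e; first by rewrite expr0 mul1r -[k]add0n e.
  exists (x ^+ i * y ^+ k); rin; by rewrite exprS; ring.
have [I0 [_ _]] := hP 0%N isT.
have P1 := hP 1%N isT; have [I1 [P11 _]] := P1; have [I2 [P21 _]] := hP 2%N isT.
have [_ ns] := hs 0%N isT.
have [p Pp nPp] := not_incl ns.
have [_ []] := hs 1%N isT; move=> z P2z.
have p0 : p != 0 by apply/eqP => p0; apply: nPp; rewrite p0; apply: (id0 I0).
have Px : P 1%N x.
  have [N [c Rc e]] := power_dvd hl noeth nx hd (id_sub I1 Pp) p0.
  by apply: (prime_exp P1 hR Rx (n := N)); rewrite e; apply: (idM I1).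
have Py : P 1%N y.
  by have [c Rc e] := hy; apply: (prime_exp P1 hR Ry (n := n)); rewrite e; apply: (idM I1).
have /hm [r [s [Rr Rs ->]]] := proper_sub_nonunits I2 P21 P2z.
by apply: (idD I1); apply: (idM I1).
Qed.

(** The last two clauses are what remains of dimension two: neither parameter is nilpotent modulo
    the other. [rlr_reg] and [reg_rlr] translate in both directions. *)
Definition reg R x y : Prop := [/\ is_local R, noetherian R, maxgen R x y,
  forall n, ~ dvdr R x (y ^+ n) & forall n, ~ dvdr R y (x ^+ n)].

Lemma regC R x y : reg R x y -> reg R y x.
Proof. by case=> h1 h2 h3 h4 h5; split=> //; apply: maxgenC. Qed.

Lemma rlr_maxgen R : regular_local_dim2 R -> exists x y, maxgen R x y.
Proof.
move=> [hl [_ [_ [x [y /generated_spanP [h1 h2]]]]]]; exists x, y => z.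
split=> [/h2 [r [_ [Rr [s [_ [Rs -> ->]] ->]]]]|[r [s [Rr Rs ->]]]].
  by exists r, s; split=> //; rewrite addr0.
have hI := local_id hl.
by apply: (idD hI); apply: (idM hI) => //; apply: h1; rewrite !inE eqxx ?orbT.
Qed.

Lemma rlr_reg R x y : regular_local_dim2 R -> maxgen R x y -> reg R x y.
Proof.
move=> [hl [hn [[hc _] _]]] hm; split=> // n hd.
  exact: no_chain2 hl hn hm hd hc.
exact: no_chain2 hl hn (maxgenC hm) hd hc.
Qed.

Section Reg.
Variables (R : F -> Prop) (x y : F).
Hypothesis hreg : reg R x y.
Let hl : is_local R. Proof. by case: hreg. Qed.
Let noeth : noetherian R. Proof. by case: hreg. Qed.
Let hm : maxgen R x y. Proof. by case: hreg. Qed.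
Let hR : is_subring R. Proof. exact: local_sub hl. Qed.
Let nx : nonunits R x. Proof. exact: maxgenl hR hm. Qed.
Let ny : nonunits R y. Proof. exact: maxgenr hR hm. Qed.
Let Rx : R x. Proof. exact: nonunits_sub nx. Qed.
Let Ry : R y. Proof. exact: nonunits_sub ny. Qed.
Let hdx : is_ideal R (dvdr R x). Proof. exact: dvdr_ideal. Qed.

Lemma reg_neq0 : x != 0.
Proof.
apply/eqP => x0; case: hreg => _ _ _ _ /(_ 1%N); apply; rewrite expr1 x0.
by exists 0; rin; ring.
Qed.

(** [R/xR] is a discrete valuation ring with uniformizer [y]. An element violating the conclusion
    is, modulo [x], a multiple of [y] by another one, so Nakayama puts all of them in [xR]. *)
Lemma reg_decomp a : R a -> ~ dvdr R x a ->
  exists j u c, [/\ R u, ~ nonunits R u, R c & a = u * y ^+ j + c * x].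
Proof.
move=> Ra nd; apply: NNPP => hno; apply: nd.
pose M a := R a /\ ~ exists j u c, [/\ R u, ~ nonunits R u, R c & a = u * y ^+ j + c * x].
have Ma : M a by [].
move: a Ma {Ra hno}; apply: (nakayama hl noeth hdx ny); first by move=> a [].
move=> a [Ra hno].
have /hm [r [s [Rr Rs e]]] : nonunits R a.
  apply: NNPP => na; apply: hno; exists 0%N, a, 0; split; rin; by rewrite expr0; ring.
exists s; last by rewrite e; exists r => //; ring.
split=> // -[j [u [c [Ru nu Rc es]]]]; apply: hno.
exists j.+1, u, (r + c * y); split; rin; by rewrite e es exprS; ring.
Qed.

(** Modulo [x] the factors are units times [y ^+ j] and [y ^+ k]; if [x] divided the product it
    would divide [y ^+ (j + k)]. *)
Lemma reg_prime a b : R a -> R b -> dvdr R x (a * b) -> dvdr R x a \/ dvdr R x b.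
Proof.
move=> Ra Rb [d Rd hab]; apply: NNPP => /not_or_and [/(reg_decomp Ra) [j [u [c [Ru nu Rc ea]]]]].
move=> /(reg_decomp Rb) [k [v [e [Rv nv Re eb]]]].
have [u0 Ru'] := unit_inv Ru nu; have [v0 Rv'] := unit_inv Rv nv.
case: hreg => _ _ _ /(_ (j + k)%N) + _; apply.
exists (u^-1 * v^-1 * (d - u * y ^+ j * e - c * b)); first by rin.
have -> : y ^+ (j + k) = u^-1 * v^-1 * ((u * y ^+ j) * (v * y ^+ k)).
  by rewrite exprD; field; rewrite u0 v0.
have -> : u * y ^+ j = a - c * x by rewrite ea; ring.
have -> : v * y ^+ k = b - e * x by rewrite eb; ring.
rewrite -[RHS]mulrA; congr (_ * _).
transitivity (a * b - (a - c * x) * e * x - c * b * x); first by ring.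
by rewrite hab; ring.
Qed.

(** Let [g] in [I] have the least order in [y] modulo [x]. It generates [I] modulo [x], and
    saturation turns the remainder into [x] times an element of [I], so that [I = gR + xI]. *)
Lemma saturated_principal I : is_ideal R I -> (forall d, R d -> I (x * d) -> I d) ->
  exists2 g, I g & incl I (dvdr R g).
Proof.
move=> hI sat.
case: (classic (incl I (dvdr R x))) => [Ix|nIx].
  exists 0; first exact: (id0 hI).
  have h0 : is_ideal R (dvdr R 0) by apply: dvdr_ideal => //; apply: sr0.
  apply: (nakayama hl noeth h0 nx); first exact: (id_sub hI).
  move=> a Ia; have [c Rc e] := Ix a Ia; exists c.
    by apply: sat => //; rewrite mulrC -e.
  by rewrite e; exists 0; rin; ring.
pose Q j := exists a u c, [/\ I a, R u, ~ nonunits R u, R c & a = u * y ^+ j + c * x].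
have [|j [g [u [c [Ig Ru nu Rc eg]]]] jmin] := @ex_minimal Q.
  have [a Ia na] := not_incl nIx.
  have [j [u [c [Ru nu Rc e]]]] := reg_decomp (id_sub hI Ia) na.
  by exists j, a, u, c.
exists g => //; have Rg := id_sub hI Ig.
apply: (nakayama hl noeth (dvdr_ideal hR Rg) nx); first exact: (id_sub hI).
move=> a Ia.
have [q [Rq [d Rd e]]] : exists q, R q /\ dvdr R x (a - q * g).
  case: (classic (dvdr R x a)) => [[d Rd e]|na].
    by exists 0; split; rin; exists d => //; rewrite e; ring.
  have [k [v [d [Rv nv Rd e]]]] := reg_decomp (id_sub hI Ia) na.
  have /subnK ek : (j <= k)%N by apply: jmin; exists a, v, d.
  have [u0 Ru'] := unit_inv Ru nu.
  exists (v * u^-1 * y ^+ (k - j)); split; rin.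
  exists (d - v * u^-1 * y ^+ (k - j) * c); rin.
  by rewrite e eg -{1}ek exprD; field.
exists d; last first.
  by exists q => //; rewrite mulrC -e; ring.
apply: sat => //; rewrite mulrC -e; apply: (idB hR hI) => //; exact: (idM hI).
Qed.

(** A prime without [x] is saturated, hence principal. A prime that strictly contains [xR] contains
    a unit times a power of [y] modulo [x], hence [y]. *)
Lemma reg_primes P : is_prime_ideal R P ->
  (exists2 g, P g & incl P (dvdr R g)) \/ incl (nonunits R) P.
Proof.
move=> hP; have [hI [P1 pP]] := hP.
case: (classic (P x)) => [Px|nPx]; last first.
  by left; apply: saturated_principal => // d Rd /(pP _ _ Rx Rd) [].
case: (classic (incl P (dvdr R x))) => [Ix|nIx]; first by left; exists x.
right; have [a Pa na] := not_incl nIx.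
have [j [u [c [Ru nu Rc e]]]] := reg_decomp (id_sub hI Pa) na.
have [u0 Ru'] := unit_inv Ru nu.
have Py : P y.
  apply: (prime_exp hP hR Ry (n := j)).
  have -> : y ^+ j = u^-1 * (a - c * x) by rewrite e; field.
  by apply: (idM hI) => //; apply: (idB hR hI) => //; apply: (idM hI).
by move=> z /hm [r [s [Rr Rs ->]]]; apply: (idD hI); apply: (idM hI).
Qed.

Lemma reg_rlr : regular_local_dim2 R.
Proof.
split=> //; split=> //; split; last first.
  exists x, y; apply/generated_spanP; split.
    by move=> g; rewrite !inE => /orP [] /eqP ->.
  move=> z /hm [r [s [Rr Rs ->]]]; exists r, (s * y); split=> //.
  by exists s, 0; split=> //; rewrite addr0.
split.
  pose P n : F -> Prop :=
    match n with 0%N => fun z => z = 0 | 1%N => dvdr R x | _ => nonunits R end.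
  exists P; split; last first.
    case=> [|[|//]] _; rewrite /P; split.
    - by move=> _ ->; exists 0; rin; ring.
    - by move=> /(_ x (dvdr_refl x hR)) /eqP; rewrite (negPf reg_neq0).
    - by move=> _ [c Rc ->]; apply: (idM (local_id hl)).
    - move=> /(_ y ny); case: hreg => _ _ _ /(_ 1%N) + _; by rewrite expr1.
  case=> [|[|[|//]]] _; rewrite /P; last exact: nonunits_prime.
    split; last split; last by move=> a b _ _ /eqP; rewrite mulf_eq0 => /orP [] /eqP; [left|right].
      split; first by move=> _ ->; rin.
      by split=> //; split=> [_ _ -> ->|r _ _ ->]; rewrite ?addr0 ?mulr0.
    by move/eqP; rewrite oner_eq0.
  split=> //; split; last by move=> a b; apply: reg_prime.
  by case=> c Rc e; apply: (nonunitsN1 nx Rc); rewrite mulrC -e.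
move=> [P [hP hs]].
(* In a chain of four primes the first three are not maximal, hence principal. If [g] and [h]
   generate the second and third, then [g = c h] with [h] outside the second, so [c = d g], and
   cancelling [g] makes [h] a unit. *)
have prin i : (i < 3)%N -> exists2 g, P i g & incl (P i) (dvdr R g).
  move=> hi; case: (reg_primes (hP i (ltnW hi))) => // sub.
  have [_ []] := hs i hi; move=> z Pz; apply: sub.
  have [hI [h1 _]] := hP i.+1 hi; exact: proper_sub_nonunits hI h1 Pz.
have [g Pg gP] := prin 1%N isT; have [h Ph hPr] := prin 2%N isT.
have [I0 _] := hP 0%N isT; have [I1 [P11 pP1]] := hP 1%N isT; have [I2 [P21 _]] := hP 2%N isT.
have [s01 n01] := hs 0%N isT; have [s12 n12] := hs 1%N isT.
have nP1h : ~ P 1%N h.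
  by move=> P1h; apply: n12 => z /hPr [c Rc ->]; apply: (idM I1).
have [c Rc e] := hPr _ (s12 _ Pg).
have Rh := id_sub I2 Ph.
have [|/gP [d Rd ed]|//] := pP1 c h Rc Rh; first by rewrite -e.
case: (eqVneq g 0) => [g0|g0].
  by apply: n01 => z /gP [q Rq ->]; rewrite g0 mulr0; apply: (id0 I0).
apply: P21; have -> : 1 = d * h.
  by apply: (mulIf g0); rewrite mul1r {1}e ed; ring.
exact: (idM I2).
Qed.

End Reg.
End Chains.

(** * Reduced fractions, normality and residual transcendence *)

Section Normality.
Variable F : fieldType.
Implicit Types (R D I J L M P A S : F -> Prop) (a b c d g x y z t u v w : F).

Definition ideal2 R a b z : Prop := exists r s, [/\ R r, R s & z = r * a + s * b].

(** The elements carried into [(a, b)] by some power of [x] form an ideal saturated by [x], so it is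
    principal; its generator [g] is the common factor to be removed. *)
Lemma coprime_step R x y a b : reg R x y -> R a -> R b -> b != 0 ->
  exists g a' b' N, [/\ R g, R a', R b', a = a' * g /\ b = b' * g & ideal2 R a' b' (x ^+ N)].
Proof.
move=> hreg Ra Rb b0; have [hl _ hm _ _] := hreg; have hR := local_sub hl.
have Rx := nonunits_sub (maxgenl hR hm).
pose K d := R d /\ exists N, ideal2 R a b (x ^+ N * d).
have hK : is_ideal R K.
  split; first by move=> z [].
  split; first by split; rin; exists 0%N, 0, 0; split; rin; ring.
  split=> [z z' [Rz [N [r [s [Rr Rs e]]]]] [Rz' [N' [r' [s' [Rr' Rs' e']]]]]|q z Rq [Rz]].
    split; rin; exists (N + N')%N, (x ^+ N' * r + x ^+ N * r'), (x ^+ N' * s + x ^+ N * s').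
    split; rin; rewrite exprD.
    transitivity (x ^+ N' * (x ^+ N * z) + x ^+ N * (x ^+ N' * z')); first by ring.
    by rewrite e e'; ring.
  move=> [N [r [s [Rr Rs e]]]]; split; rin; exists N, (q * r), (q * s); split; rin.
  by rewrite mulrCA e; ring.
have [|g [Rg [N [r [s [Rr Rs eg]]]]] gK] := saturated_principal hreg hK.
  move=> d Rd [_ [N [r [s [Rr Rs e]]]]]; split=> //; exists N.+1, r, s; split=> //.
  by rewrite -e exprSr mulrA.
have [|a' Ra' ea] := gK a; first by split=> //; exists 0%N, 1, 0; split; rin; ring.
have [|b' Rb' eb] := gK b; first by split=> //; exists 0%N, 0, 1; split; rin; ring.
exists g, a', b', N; split=> //; exists r, s; split=> //.
have g0 : g != 0 by apply: contraNneq b0 => g0; rewrite eb g0 mulr0.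
by apply: (mulIf g0); rewrite eg ea eb; ring.
Qed.

Lemma ideal2X R a b x N m : is_subring R -> R x -> (N <= m)%N ->
  ideal2 R a b (x ^+ N) -> ideal2 R a b (x ^+ m).
Proof.
move=> hR Rx /subnK <- [r [s [Rr Rs e]]]; exists (x ^+ (m - N) * r), (x ^+ (m - N) * s).
by split; rin; rewrite exprD e; ring.
Qed.

Lemma coprime_fraction R x y a b : reg R x y -> R a -> R b -> b != 0 ->
  exists a' b' N, [/\ R a', R b', b' != 0, a / b = a' / b' &
    ideal2 R a' b' (x ^+ N) /\ ideal2 R a' b' (y ^+ N)].
Proof.
move=> hreg Ra Rb b0; have [hl _ hm _ _] := hreg; have hR := local_sub hl.
have Rx := nonunits_sub (maxgenl hR hm); have Ry := nonunits_sub (maxgenr hR hm).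
have [g [a1 [b1 [N [Rg Ra1 Rb1 [ea eb] hN]]]]] := coprime_step hreg Ra Rb b0.
have g0 : g != 0 by apply: contraNneq b0 => g0; rewrite eb g0 mulr0.
have b10 : b1 != 0 by apply: contraNneq b0 => b10; rewrite eb b10 mul0r.
have [h [a2 [b2 [M [Rh Ra2 Rb2 [ea1 eb1] hM]]]]] := coprime_step (regC hreg) Ra1 Rb1 b10.
have h0 : h != 0 by apply: contraNneq b10 => h0; rewrite eb1 h0 mulr0.
have b20 : b2 != 0 by apply: contraNneq b10 => b20; rewrite eb1 b20 mul0r.
exists a2, b2, (maxn N M); split=> //.
  by rewrite ea eb ea1 eb1; field; rewrite g0 h0 b20.
split; last by apply: (ideal2X (N := M)) => //; rewrite leq_maxr.
apply: (ideal2X (N := N)) => //; first by rewrite leq_maxl.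
have [r [s [Rr Rs ->]]] := hN; exists (r * h), (s * h); split; rin.
by rewrite ea1 eb1; ring.
Qed.

(** [x] does not divide [h], since it would then divide [y ^+ N]. As [x] is prime, its factors can
    be cancelled one by one from [x ^+ N = c * h]. *)
Lemma reg_unit R x y h N : reg R x y -> R h -> dvdr R h (x ^+ N) -> dvdr R h (y ^+ N) ->
  ~ nonunits R h.
Proof.
move=> hreg Rh hx [e Re ey]; have [hl _ hm hyx _] := hreg; have hR := local_sub hl.
have nx := maxgenl hR hm; have Rx := nonunits_sub nx.
have ndx : ~ dvdr R x h.
  by move=> [d Rd ed]; apply: (hyx N); exists (e * d); rin; rewrite ey ed mulrA.
elim: N hx {ey} => [|N IH] [c Rc ec].
  by move=> nh; apply: (nonunitsN1 nh Rc); rewrite mulrC -ec.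
have [|[d Rd ed]|//] := reg_prime hreg Rc Rh.
  by rewrite -ec exprS; exists (x ^+ N); rin; ring.
apply: IH; exists d => //; apply: (mulfI (reg_neq0 hreg)).
by rewrite -exprS ec ed; ring.
Qed.

Definition int_closed R : Prop := forall c n (d : nat -> F), (forall i, R (d i)) ->
  c ^+ n = \sum_(i < n) d i * c ^+ i -> R c.

Lemma sr_sum R n (f : 'I_n -> F) : is_subring R -> (forall i, R (f i)) -> R (\sum_(i < n) f i).
Proof. by move=> hR hf; apply: (big_ind R); [exact: sr0|exact: srD|]. Qed.

Lemma id_sum R I n (f : 'I_n -> F) (Q : pred 'I_n) : is_ideal R I ->
  (forall i, Q i -> I (f i)) -> I (\sum_(i < n | Q i) f i).
Proof. by move=> hI hf; apply: (big_ind I); [exact: (id0 hI)|exact: (idD hI)|]. Qed.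

Lemma id_addX R I u v n : is_subring R -> is_ideal R I -> R u -> I v -> I (u ^+ n) ->
  I ((u + v) ^+ n).
Proof.
move=> hR hI Ru Iv Iu; have Rv := id_sub hI Iv.
have : I ((u + v) ^+ n - u ^+ n).
  elim: n {Iu} => [|n IH]; first by rewrite !expr0 subrr; apply: (id0 hI).
  have -> : (u + v) ^+ n.+1 - u ^+ n.+1 = (u + v) * ((u + v) ^+ n - u ^+ n) + u ^+ n * v.
    by rewrite !exprS; ring.
  by apply: (idD hI); apply: (idM hI) => //; rin.
by move=> h; rewrite -[_ ^+ n](subrK (u ^+ n)); apply: (idD hI).
Qed.

(** Clearing denominators in the integral equation of a reduced [a / b] shows that [b] divides
    [a ^+ n]. Then [b] divides powers of [x] and of [y], so it is a unit. *)
Lemma reg_int_closed R x y : is_quotient_field R -> reg R x y -> int_closed R.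
Proof.
move=> hq hreg c n d Rd; have [hl _ hm _ _] := hreg; have hR := local_sub hl.
have [a0 [b0 [Ra0 [Rb0 [b00 ->]]]]] := hq c.
have [a [b [N [Ra Rb b_neq0 -> [hx hy]]]]] := coprime_fraction hreg Ra0 Rb0 b00 => e.
have hI := dvdr_ideal hR Rb.
have Ian : dvdr R b (a ^+ n).
  have -> : a ^+ n = \sum_(i < n) d i * a ^+ i * b ^+ (n - i.+1) * b.
    have -> : a ^+ n = (a / b) ^+ n * b ^+ n by rewrite expr_div_n divfK // expf_neq0.
    rewrite e mulr_suml; apply: eq_bigr => i _.
    have -> : b ^+ n = b ^+ (n - i.+1) * (b ^+ i * b) by rewrite -exprSr -exprD subnK.
    rewrite expr_div_n.
    by field; rewrite expf_neq0.
  apply: (id_sum hI) => i _; exists (d i * a ^+ i * b ^+ (n - i.+1)) => //; by have ? := Rd i; rin.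
have pw w : ideal2 R a b (w ^+ N) -> dvdr R b (w ^+ (N * n)).
  move=> [r [s [Rr Rs ew]]]; rewrite exprM ew; apply: (id_addX hR hI); rin.
    by exists s.
  by rewrite exprMn; apply: (idM hI) => //; rin.
have [_ Rb'] := unit_inv Rb (reg_unit hreg Rb (pw _ hx) (pw _ hy)).
by rin.
Qed.

Definition polyin R (p : {poly F}) : Prop := forall i, R p`_i.

(* [z] is residually transcendental over the local ring [R]. *)
Definition rtrans R z : Prop := forall p, polyin R p -> p.[z] = 0 -> polyin (nonunits R) p.

Lemma nonunits0 R : is_subring R -> nonunits R 0.
Proof.
move=> hR; split; first exact: sr0.
by move=> [w [_ /eqP]]; rewrite mul0r eq_sym oner_eq0.
Qed.

(* If [p = sum_(i <= n) c_i T^i] vanishes at [z] then [c_n z] is integral over [R], hence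
   in [R], and it is a nonunit since [z^-1] is not in [R]; now lower the degree by replacing
   [c_n z^n] with [(c_n z) z^(n-1)]. *)
Lemma residually_transcendental R z : is_local R -> int_closed R -> ~ R z -> ~ R z^-1 -> rtrans R z.
Proof.
move=> hl hic nz nz' p; have hR := local_sub hl; have hI := local_id hl.
have z0 : z != 0 by apply/eqP => z0; apply: nz; rewrite z0; rin.
have [n] := ubnP (size p); elim: n p => // n IH p; rewrite ltnS => le_sp Rp pz.
case: n IH le_sp => [|[|n]] IH le_sp.
- by move: le_sp; rewrite leqn0 size_poly_eq0 => /eqP -> i; rewrite coef0; apply: nonunits0.
- move: pz; rewrite [p]size1_polyC // hornerC => -> i; rewrite coefC if_same; exact: nonunits0.
set q := p`_n.+1; pose c := q * z.
have Rq : R q by apply: Rp.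
have Rc : R c.
  apply: (hic c n.+1 (fun i => - p`_i * q ^+ (n - i))); first by move=> i; have ? := Rp i; rin.
  have := pz; rewrite (horner_coef_wide _ le_sp) big_ord_recr /= -/q => e.
  have := congr1 (fun w => q ^+ n * w) e; rewrite mulr0 mulrDr.
  have -> : q ^+ n * (q * z ^+ n.+1) = c ^+ n.+1 by rewrite exprMn mulrA -exprSr.
  move/eqP; rewrite addrC addr_eq0 => /eqP ->.
  rewrite mulr_sumr -sumrN; apply: eq_bigr => i _.
  rewrite exprMn -{1}(subnK (leq_ord i)) exprD; ring.
have nc : nonunits R c.
  apply: NNPP => /(unit_inv Rc) [c0 Rc']; apply: nz'.
  have -> : z^-1 = q * c^-1.
    by rewrite /c; move: c0; rewrite mulf_eq0 negb_or => /andP [h _]; field; rewrite z0 h.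
  by rin.
have nq : nonunits R q.
  apply: NNPP => /(unit_inv Rq) [q0 Rq']; apply: nz.
  by have -> : z = q^-1 * c; [rewrite mulKf|rin].
pose p' : {poly F} := p - q%:P * ('X^(n.+1) - z%:P * 'X^n).
have cp' i : p'`_i = p`_i - q * (i == n.+1)%:R + c * (i == n)%:R.
  rewrite /p' coefB coefCM coefB coefCM !coefXn /c; ring.
have hp' : polyin (nonunits R) p'.
  apply: IH.
  - apply/leq_sizeP => j lej; rewrite cp'; move: lej; rewrite leq_eqVlt => /orP [/eqP <-|ltj].
      by rewrite eqxx -/q (gtn_eqF (ltnSn n)) mulr0 mulr1 subrr addr0.
    rewrite (gtn_eqF ltj) (gtn_eqF (ltnW ltj)) !mulr0 subr0 addr0.
    by apply: (leq_sizeP _ _ le_sp).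
  - move=> i; rewrite cp'; have ? := Rp i.
    by case: (i == n.+1); case: (i == n); rewrite ?mulr0 ?mulr1; rin.
  - by rewrite !(hornerE, hornerXn) pz /= exprS; ring.
move=> i; have -> : p`_i = p'`_i + ((i == n.+1)%:R * q - (i == n)%:R * c) by rewrite cp'; ring.
apply: (idD hI) => //; apply: (idB hR hI); apply: (idM hI) => //.
  by case: (_ == _); rewrite ?mulr0n ?mulr1n; rin.
by case: (_ == _); rewrite ?mulr0n ?mulr1n; rin.
Qed.

End Normality.

Lemma span0 (T : comNzRingType) (R : T -> Prop) s : R 0 -> span R s 0.
Proof. by move=> R0; elim: s => //= g s IH; exists 0, 0; split=> //; rewrite mul0r addr0. Qed.

Lemma span_cons (T : comNzRingType) (R : T -> Prop) g s z : R 0 -> span R s z -> span R (g :: s) z.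
Proof. by move=> R0 sz; exists 0, z; split=> //; rewrite mul0r add0r. Qed.

Lemma spanD (T : comNzRingType) (R : T -> Prop) s z z' :
  (forall a b, R a -> R b -> R (a + b)) -> span R s z -> span R s z' -> span R s (z + z').
Proof.
move=> RD; elim: s z z' => [|g s IH] z z' /=; first by move=> -> ->; rewrite addr0.
move=> [r [y [Rr sy ->]]] [r' [y' [Rr' sy' ->]]]; exists (r + r'), (y + y').
by split; [exact: RD|exact: IH|ring].
Qed.

Lemma spanM (T : comNzRingType) (R : T -> Prop) s c z :
  (forall a b, R a -> R b -> R (a * b)) -> R c -> span R s z -> span R s (c * z).
Proof.
move=> RM Rc; elim: s z => [|g s IH] z /=; first by move=> ->; rewrite mulr0.
move=> [r [y [Rr sy ->]]]; exists (c * r), (c * y).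
by split; [exact: RM|exact: IH|ring].
Qed.

(** * Polynomials over a subring and the extension [R[t]] *)

Section Extensions.
Variable F : fieldType.
Implicit Types (R D I J L M P A S : F -> Prop) (a b c d g x y z t u v w : F).
Implicit Types (p q r : {poly F}).

Lemma polyin0 R : is_subring R -> polyin R 0.
Proof. by move=> hR i; rewrite coef0; rin. Qed.
Lemma polyinC R c : is_subring R -> R c -> polyin R c%:P.
Proof. by move=> hR Rc i; rewrite coefC; case: eqP => _; rin. Qed.
Lemma polyinX R : is_subring R -> polyin R 'X.
Proof. by move=> hR i; rewrite coefX; case: eqP => _; rin. Qed.
Lemma polyinD R p q : is_subring R -> polyin R p -> polyin R q -> polyin R (p + q).
Proof. by move=> hR hp hq i; rewrite coefD; apply: (srD hR). Qed.
Lemma polyinN R p : is_subring R -> polyin R p -> polyin R (- p).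
Proof. by move=> hR hp i; rewrite coefN; apply: (srN hR). Qed.
Lemma polyinM R p q : is_subring R -> polyin R p -> polyin R q -> polyin R (p * q).
Proof. by move=> hR hp hq i; rewrite coefM; apply: sr_sum => // j; apply: (srM hR). Qed.
Lemma polyinX_n R n : is_subring R -> polyin R 'X^n.
Proof. by move=> hR i; rewrite coefXn; case: eqP => _; rin. Qed.

Lemma polyin_idD R I p q : is_ideal R I -> polyin I p -> polyin I q -> polyin I (p + q).
Proof. by move=> hI hp hq i; rewrite coefD; apply: (idD hI). Qed.
Lemma polyin_idM R I p q : is_ideal R I -> polyin R p -> polyin I q -> polyin I (p * q).
Proof. by move=> hI hp hq i; rewrite coefM; apply: (id_sum hI) => j _; apply: (idM hI). Qed.
Lemma polyin_incl I J p : incl I J -> polyin I p -> polyin J p.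
Proof. by move=> IJ hp i; apply: IJ. Qed.

(* For an ideal [I] of [R], [adj I t] is the extended ideal [I R[t]]. *)
Definition adj R t w : Prop := exists2 p, polyin R p & w = p.[t].

Lemma adj_subring R t : is_subring R -> is_subring (adj R t).
Proof.
move=> hR; split; first by exists 0; [exact: polyin0|rewrite horner0].
split; first by exists 1%:P; [by apply: polyinC; rin|rewrite hornerC].
split; first by move=> _ _ [p hp ->] [q hq ->]; exists (p + q); [exact: polyinD|rewrite hornerD].
split; first by move=> _ [p hp ->]; exists (- p); [exact: polyinN|rewrite hornerN].
by move=> _ _ [p hp ->] [q hq ->]; exists (p * q); [exact: polyinM|rewrite hornerM].
Qed.

Lemma adj_sub R t c : is_subring R -> R c -> adj R t c.
Proof. by move=> hR Rc; exists c%:P; [exact: polyinC|rewrite hornerC]. Qed.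

Lemma adj_gen R t : is_subring R -> adj R t t.
Proof. by move=> hR; exists 'X; [exact: polyinX|rewrite hornerX]. Qed.

Lemma adj_incl R S t : incl R S -> incl (adj R t) (adj S t).
Proof. by move=> RS w [p hp ->]; exists p => // i; apply: RS. Qed.

Lemma adj_min R S t : is_subring S -> incl R S -> S t -> incl (adj R t) S.
Proof.
move=> hS RS St _ [p hp ->]; rewrite horner_coef; apply: sr_sum => // i.
by have ? := RS _ (hp i); rin.
Qed.

Lemma adj_ideal R I t : is_ideal R I -> is_ideal (adj R t) (adj I t).
Proof.
move=> hI; split; first by apply: adj_incl; apply: id_sub hI.
split; first by exists 0; [move=> i; rewrite coef0; exact: (id0 hI)|rewrite horner0].
split=> [_ _ [p hp ->] [q hq ->]|_ _ [p hp ->] [q hq ->]].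
  by exists (p + q); [exact: (polyin_idD hI)|rewrite hornerD].
by exists (p * q); [exact: (polyin_idM hI)|rewrite hornerM].
Qed.

Lemma span_is_ideal R (s : seq F) : is_subring R -> (forall g, g \in s -> R g) ->
  is_ideal R (span R s).
Proof.
move=> hR sR; split.
  move=> z; elim: s sR z => [|g s IH] sR z /=; first by move=> ->; rin.
  move=> [r [y [Rr sy ->]]]; have ? : R g by apply: sR; rewrite inE eqxx.
  have ? : R y by apply: IH sy => h hs; apply: sR; rewrite inE hs orbT.
  by rin.
split; first by apply: span0; rin.
split; first by move=> z z'; apply: spanD => a b; apply: (srD hR).
by move=> r z Rr; apply: spanM => // a b; apply: (srM hR).
Qed.

Lemma lead_coef_lift R (s : seq {poly F}) m a : is_subring R ->
  (forall p, p \in s -> (size p <= m.+1)%N) -> span R (map lead_coef s) a ->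
  exists q, [/\ span (polyin R) s q, (size q <= m.+1)%N & q`_m = a].
Proof.
move=> hR; elim: s a => [|g s IH] a hs /=.
  by move->; exists 0; rewrite size_poly0 coef0.
move=> [r [a' [Rr sa' ->]]].
have [|q [sq szq qm]] := IH a' _ sa'; first by move=> p ps; apply: hs; rewrite inE ps orbT.
have sg : (size g <= m.+1)%N by apply: hs; rewrite inE eqxx.
exists (r%:P * 'X^(m.+1 - size g) * g + q); split.
- exists (r%:P * 'X^(m.+1 - size g)), q; split=> //.
  by apply: polyinM => //; [exact: polyinC|exact: polyinX_n].
- apply: (leq_trans (size_polyD _ _)); rewrite geq_max szq andbT -mulrA mul_polyC.
  apply: (leq_trans (size_scale_leq _ _)); apply: (leq_trans (size_polyMleq _ _)).
  by rewrite size_polyXn addSn /= subnK.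
rewrite coefD qm -mulrA coefCM coefXnM lead_coefE.
case: (posnP (size g)) => [/eqP|g0].
  by rewrite size_poly_eq0 => /eqP ->; rewrite !coef0 if_same.
by move: sg g0; case: (size g) => // k sg _; rewrite subSS subKn // ltnNge leq_subr.
Qed.

(** Hilbert's basis argument on the preimage of [I] in the polynomial ring, since elements of [R[t]]
    need not have a degree. Each new polynomial has least size outside the span of the earlier ones;
    once the leading coefficient ideals stop growing, [lead_coef_lift] produces a smaller one. *)
Lemma adj_noetherian R t : is_subring R -> noetherian R -> noetherian (adj R t).
Proof.
move=> hR noeth I hI.
have R0 : polyin R 0 by apply: polyin0.
pose pI p := polyin R p /\ I p.[t].
suff [s sI Is] : exists2 s, (forall p, p \in s -> pI p) & (forall p, pI p -> span (polyin R) s p).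
  exists (map (fun p => p.[t]) s); apply/generated_spanP; split.
    by move=> _ /mapP [p /sI [_ h] ->].
  move=> z Iz; have [p hp ez] := id_sub hI Iz.
  have {Iz} : span (polyin R) s p by apply: Is; split=> //; rewrite -ez.
  rewrite {}ez {hp sI Is}; elim: s p => [|g s IH] p /=; first by move->; rewrite horner0.
  move=> [r [q [hr sq ->]]]; exists r.[t], q.[t]; split; first by exists r.
    exact: IH.
  by rewrite hornerD hornerM.
apply: NNPP => hno.
pose E (s s' : seq {poly F}) := exists p, [/\ s' = p :: s, pI p, ~ span (polyin R) s p &
  forall q, pI q -> ~ span (polyin R) s q -> (size p <= size q)%N].
have step s : (forall p, p \in s -> pI p) -> exists2 s', (forall p, p \in s' -> pI p) & E s s'.
  move=> sI; pose Q n := exists p, [/\ pI p, ~ span (polyin R) s p & size p = n].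
  have [|n [p [Ip nsp en]] nmin] := @ex_minimal Q.
    apply: NNPP => hno'; apply: hno; exists s => // p Ip; apply: NNPP => nsp.
    by apply: hno'; exists (size p), p.
  exists (p :: s); first by move=> q; rewrite inE => /orP [/eqP ->|/sI].
  by exists p; split=> // q Iq nsq; rewrite en; apply: nmin; exists q.
have [|f [f0 fI Ef]] := @dependent_choice _ (fun s => forall p, p \in s -> pI p) E [::] _ step.
  by [].
have hL n : is_ideal R (span R (map lead_coef (f n))).
  apply: span_is_ideal => // _ /mapP [p /fI [hp _] ->]; exact: hp.
have [|N hN] := noetherian_acc noeth hL.
  by move=> n z; have [p [-> _ _ _]] := Ef n; apply: span_cons; rin.
have szf n q p : q \in f n -> pI p -> ~ span (polyin R) (f n) p -> (size q <= size p)%N.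
  elim: n q => [|n IH] q; first by rewrite f0.
  have [g [-> Ig nsg gmin]] := Ef n; rewrite inE => qf Ip nsp.
  have nsp' : ~ span (polyin R) (f n) p by move=> h; apply: nsp; apply: span_cons.
  by case/orP: qf => [/eqP ->|qf]; [apply: gmin|apply: IH].
have [p [ef Ip nsp pmin]] := Ef N.
have lp : span R (map lead_coef (f N)) (lead_coef p).
  apply: (hN N.+1); rewrite ef; exists 1, 0; split; rin; last by ring.
  by apply: span0; rin.
have p0 : p != 0 by apply/eqP => p0; apply: nsp; rewrite p0; apply: span0.
have [m em] : exists m, size p = m.+1.
  by exists (size p).-1; rewrite prednK // lt0n size_poly_eq0.
have [|q [sq szq qm]] := lead_coef_lift (m := m) hR _ lp.
  by move=> q qf; rewrite -em; apply: szf qf Ip nsp.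
have polyin_span (s : seq {poly F}) : (forall p, p \in s -> pI p) ->
    forall q, span (polyin R) s q -> pI q.
  move=> sI; elim: s sI => [|g s IH] sI r /=.
    by move->; split; [exact: polyin0|rewrite horner0; exact: (id0 hI)].
  move=> [h [k [hh sk ->]]]; have [hk Ik] : pI k.
    by apply: IH sk => l ls; apply: sI; rewrite inE ls orbT.
  have [hg Ig] : pI g by apply: sI; rewrite inE eqxx.
  split; first by apply: polyinD => //; apply: polyinM.
  rewrite hornerD hornerM; apply: (idD hI) => //; apply: (idM hI) => //; by exists h.
have [hq Iq] := polyin_span _ (fI N) _ sq.
have [hp Ipt] := Ip.
have : (size p <= size (p - q)%R)%N.
  apply: pmin.
    split; first by apply: polyinD => //; apply: polyinN.
    by rewrite hornerD hornerN; apply: (idB (adj_subring t hR) hI).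
  move=> h; apply: nsp; rewrite -[p](subrK q); apply: spanD => // a b; exact: polyinD.
rewrite leqNgt em ltnS; case/negP; apply/leq_sizeP => j; rewrite leq_eqVlt => /orP [/eqP <-|ltj].
  by rewrite coefB qm lead_coefE em subrr.
by rewrite coefB !nth_default ?subr0 ?em //; apply: leq_trans szq ltj.
Qed.

End Extensions.

(** * Localization at a prime *)

Section Localization.
Variable F : fieldType.
Implicit Types (R D I J L M P A S : F -> Prop) (a b c d g x y z t u v w : F).

Definition locat A P w : Prop := exists p q, [/\ A p, A q, ~ P q & w = p / q].

Lemma prime_neq0 A P q : is_prime_ideal A P -> ~ P q -> q != 0.
Proof. by move=> [hI _] nq; apply/eqP => q0; apply: nq; rewrite q0; apply: (id0 hI). Qed.

Lemma locat_sub A P w : is_subring A -> is_prime_ideal A P -> A w -> locat A P w.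
Proof. by move=> hA [_ [P1 _]] Aw; exists w, 1; split; rin; rewrite divr1. Qed.

Lemma locat_subring A P : is_subring A -> is_prime_ideal A P -> is_subring (locat A P).
Proof.
move=> hA hP; have sub w := @locat_sub A P w hA hP.
split; first by apply: sub; rin.
split; first by apply: sub; rin.
have [_ [_ pP]] := hP.
split; last split.
- move=> _ _ [p [q [Ap Aq nq ->]]] [p' [q' [Ap' Aq' nq' ->]]].
  exists (p * q' + p' * q), (q * q'); split; rin; first by move=> /pP [].
  by rewrite addf_div //; apply: prime_neq0 hP _.
- by move=> _ [p [q [Ap Aq nq ->]]]; exists (- p), q; split; rin; rewrite mulNr.
- move=> _ _ [p [q [Ap Aq nq ->]]] [p' [q' [Ap' Aq' nq' ->]]].
  exists (p * p'), (q * q'); split; rin; first by move=> /pP [].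
  by rewrite mulf_div.
Qed.

Lemma locat_nonunits A P w : is_subring A -> is_prime_ideal A P ->
  nonunits (locat A P) w <-> exists p q, [/\ P p, A q, ~ P q & w = p / q].
Proof.
move=> hA hP; have [hI [P1 pP]] := hP; split.
  move=> [[p [q [Ap Aq nq e]]] nu]; exists p, q; split=> //.
  apply: NNPP => np; apply: nu; exists (q / p); split; first by exists q, p.
  by rewrite e mulf_div [q * p]mulrC divff // mulf_neq0 //; apply: prime_neq0 hP _.
move=> [p [q [Pp Aq nq ->]]]; have Ap := id_sub hI Pp; split; first by exists p, q.
move=> [_ [[p' [q' [Ap' Aq' nq' ->]]] e]].
have e' : p * p' = q * q'.
  have qq0 : q * q' != 0 by rewrite mulf_neq0 //; apply: prime_neq0 hP _.
  by rewrite -[LHS](divfK qq0) -mulf_div e mul1r.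
by have /pP [] : P (q * q'); rewrite -?e' //; apply: (idMr hI).
Qed.

Lemma locat_local A P : is_subring A -> is_prime_ideal A P -> is_local (locat A P).
Proof.
move=> hA hP; have hL := locat_subring hA hP; split=> //.
have [hI [P1 pP]] := hP; have nP w := @locat_nonunits A P w hA hP.
split; first by move=> w [].
split; first by exact: nonunits0.
split.
  move=> _ _ /nP [p [q [Pp Aq nq ->]]] /nP [p' [q' [Pp' Aq' nq' ->]]].
  apply/nP; exists (p * q' + p' * q), (q * q'); split; rin.
  - by apply: (idD hI); apply: (idMr hI).
  - by move=> /pP [].
  by rewrite addf_div //; apply: prime_neq0 hP _.
move=> _ _ [p [q [Ap Aq nq ->]]] /nP [p' [q' [Pp' Aq' nq' ->]]].
apply/nP; exists (p * p'), (q * q'); split; rin.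
- by apply: (idM hI).
- by move=> /pP [].
by rewrite mulf_div.
Qed.

Lemma locat_noetherian A P : is_subring A -> is_prime_ideal A P -> noetherian A ->
  noetherian (locat A P).
Proof.
move=> hA hP noeth I hI; have sub w := @locat_sub A P w hA hP.
have hIA : is_ideal A (fun z => A z /\ I z).
  split; first by move=> z [].
  split; first by split; [rin|exact: (id0 hI)].
  split=> [u v [Au Iu] [Av Iv]|u v Au [Av Iv]]; first by split; [rin|exact: (idD hI)].
  by split; rin; apply: (idM hI) => //; apply: sub.
have [s /generated_spanP [sI Is]] := noeth _ hIA.
exists s; apply/generated_spanP; split; first by move=> g /sI [].
move=> z Iz; have [p [q [Ap Aq nq e]]] := id_sub hI Iz.
have q0 := prime_neq0 hP nq.
have : span A s p.
  apply: Is; split=> //; have -> : p = q * z by rewrite e mulrC divfK.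
  by apply: (idM hI) => //; apply: sub.
rewrite e {e Iz sI Is Ap}; elim: s p => [|g s IH] p /=; first by move->; rewrite mul0r.
move=> [r [y [Ar sy ->]]]; exists (r / q), (y / q); split; [by exists r, q|exact: IH|by field].
Qed.

End Localization.

(** * Gauss's lemma and the extension [R(t)] *)

Section GaussExtension.
Variable F : fieldType.
Implicit Types (R D I J L M P A S V : F -> Prop) (a b c d g x y z t u v w : F).

Lemma top_unit_coef R (p : {poly F}) : is_subring R -> ~ polyin (nonunits R) p ->
  exists2 i, ~ nonunits R p`_i & forall k, (i < k)%N -> nonunits R p`_k.
Proof.
move=> hR np; have : exists n, forall k, (n <= k)%N -> nonunits R p`_k.
  by exists (size p) => k le; rewrite nth_default //; apply: nonunits0.
move=> /ex_minimal [[|n] hn nmin]; first by case: np => i; apply: hn.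
exists n => // nn; suff /nmin : forall k, (n <= k)%N -> nonunits R p`_k by rewrite ltnn.
by move=> k; rewrite leq_eqVlt => /orP [/eqP <-|/hn].
Qed.

(** Among the terms of this coefficient only [p_i q_j] is a unit: every other one contains a factor
    beyond the last unit coefficient of [p] or of [q]. The exact position is needed in
    [order_uniformization]. *)
Lemma gauss_top R (p q : {poly F}) i j : is_local R -> polyin R p -> polyin R q ->
  ~ nonunits R p`_i -> (forall k, (i < k)%N -> nonunits R p`_k) ->
  ~ nonunits R q`_j -> (forall k, (j < k)%N -> nonunits R q`_k) ->
  ~ nonunits R (p * q)`_(i + j).
Proof.
move=> hl hp hq npi imax nqj jmax; have hI := local_id hl; have hR := local_sub hl.
have lti : (i < (i + j).+1)%N by rewrite ltnS leq_addr.
rewrite coefM (bigD1 (Ordinal lti)) //= addKn => h.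
suff : nonunits R (p`_i * q`_j) by move=> /(nonunits_mul hl (hp i) (hq j)) [].
rewrite -[_ * _](addrK (\sum_(k < (i + j).+1 | k != Ordinal lti) p`_k * q`_(i + j - k))).
apply: (idB hR hI) => //; apply: (id_sum hI) => k nk.
case: (ltngtP k i) => [ltk|gtk|ek]; last by case/eqP: nk; apply: val_inj.
  by apply: (idM hI) => //; apply: jmax; rewrite ltn_subRL ltn_add2r.
by apply: (idMr hI) => //; apply: imax.
Qed.

Lemma gauss_nonunits R (p q : {poly F}) : is_local R -> polyin R p -> polyin R q ->
  polyin (nonunits R) (p * q) -> polyin (nonunits R) p \/ polyin (nonunits R) q.
Proof.
move=> hl hp hq hpq; have hR := local_sub hl; apply: NNPP => /not_or_and [np nq].
have [i npi imax] := top_unit_coef hR np; have [j nqj jmax] := top_unit_coef hR nq.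
exact: gauss_top npi imax nqj jmax (hpq _).
Qed.

(** Modulo the maximal ideal [t] is a variable: two polynomials with the same value at [t] differ by
    one that vanishes at [t], whose coefficients are nonunits. *)
Lemma rtrans_coef R t (p : {poly F}) : is_local R -> rtrans R t -> polyin R p ->
  adj (nonunits R) t p.[t] -> polyin (nonunits R) p.
Proof.
move=> hl ht hp [q hq e]; have hI := local_id hl; have hR := local_sub hl.
rewrite -[p](subrK q); apply: (polyin_idD hI) => //; apply: ht.
  by apply: polyinD => //; apply: polyinN => //; apply: polyin_incl hq => z [].
by rewrite hornerD hornerN e subrr.
Qed.

Lemma adjm_prime R t : is_local R -> rtrans R t ->
  is_prime_ideal (adj R t) (adj (nonunits R) t).
Proof.
move=> hl ht; have hI := local_id hl; have hR := local_sub hl.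
split; first exact: adj_ideal.
split.
  move=> h; have := @rtrans_coef R t 1%:P hl ht; rewrite hornerC => /(_ _ h) h'.
  apply: (nonunits1 hR); rewrite -[1](coefC 1 0).
  by apply: h'; apply: polyinC; rin.
move=> _ _ [p hp ->] [q hq ->]; rewrite -hornerM => /(rtrans_coef hl ht (polyinM hR hp hq)).
by move=> /(gauss_nonunits hl hp hq) [h|h]; [left; exists p|right; exists q].
Qed.

(** The ring [R(t)]: for residually transcendental [t] it is local with residue field a rational
    function field in one variable. For [t = y / x] it is the order valuation ring of [R]. *)
Definition gauss_ext R t : F -> Prop := locat (adj R t) (adj (nonunits R) t).

Lemma gauss_ext_local R t : is_local R -> rtrans R t -> is_local (gauss_ext R t).
Proof.
move=> hl ht; apply: locat_local; last exact: adjm_prime.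
exact/adj_subring/local_sub.
Qed.

Lemma gauss_ext_noetherian R t : is_local R -> noetherian R -> rtrans R t ->
  noetherian (gauss_ext R t).
Proof.
move=> hl hn ht; have hR := local_sub hl; apply: locat_noetherian.
- exact: adj_subring.
- exact: adjm_prime.
- exact: adj_noetherian.
Qed.

Lemma gauss_ext_adj R t w : is_local R -> rtrans R t -> adj R t w -> gauss_ext R t w.
Proof.
move=> hl ht; apply: locat_sub; last exact: adjm_prime.
exact/adj_subring/local_sub.
Qed.

Lemma gauss_ext_sub R t w : is_local R -> rtrans R t -> R w -> gauss_ext R t w.
Proof. by move=> hl ht Rw; apply: gauss_ext_adj => //; apply: adj_sub => //; apply: local_sub. Qed.

Lemma gauss_ext_nonunits R t c : is_local R -> rtrans R t -> nonunits R c ->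
  nonunits (gauss_ext R t) c.
Proof.
move=> hl ht nc; have hR := local_sub hl; have hP := adjm_prime hl ht.
apply/locat_nonunits => //; first exact: adj_subring.
exists c, 1; split; rewrite ?divr1 //.
- exists c%:P; rewrite ?hornerC // => i; rewrite coefC; case: eqP => // _; exact: nonunits0.
- by apply: adj_sub; rin.
- by case: hP => _ [].
Qed.

Lemma gauss_ext_coef R t (p : {poly F}) : is_local R -> rtrans R t -> polyin R p ->
  nonunits (gauss_ext R t) p.[t] -> polyin (nonunits R) p.
Proof.
move=> hl ht hp; have hA := adj_subring t (local_sub hl); have hP := adjm_prime hl ht.
move=> /(locat_nonunits _ hA hP) [a [b [Pa Ab nb e]]]; have [hI [_ pP]] := hP.
apply: (rtrans_coef hl ht hp).
have [||//|//] := pP p.[t] b _ Ab; first by exists p.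
by rewrite e divfK //; apply: prime_neq0 hP nb.
Qed.

Lemma rtrans_incl R S t : LD R S -> rtrans S t -> rtrans R t.
Proof.
move=> [_ [RS dom]] ht p hp pt i; apply/dom => //; exact: (ht p (polyin_incl RS hp) pt i).
Qed.

Lemma gauss_ext_incl R S t : LD R S -> rtrans S t -> incl (gauss_ext R t) (gauss_ext S t).
Proof.
move=> hLD ht _ [p [q [Ap [q' hq' eq] nq ->]]]; have [hS [RS dom]] := hLD.
exists p, q; split=> //; first exact: (adj_incl RS).
  by exists q' => //; apply: polyin_incl hq'.
move=> h; apply: nq; rewrite eq; exists q' => // i; apply/dom => //.
by apply: (rtrans_coef hS ht (polyin_incl RS hq')); rewrite -eq.
Qed.

Lemma polyin_maxgen R x y (p : {poly F}) : is_subring R -> maxgen R x y -> polyin (nonunits R) p ->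
  exists r s, [/\ polyin R r, polyin R s & p = r * x%:P + s * y%:P].
Proof.
move=> hR hm; elim/poly_ind: p => [|p c IH] hp.
  by exists 0, 0; split; [exact: polyin0|exact: polyin0|ring].
have [|r [s [hr hs e]]] := IH.
  by move=> i; have := hp i.+1; rewrite coefD coefMX coefC addr0.
have := hp 0%N; rewrite coefD coefMX coefC add0r => /hm [r' [s' [Rr' Rs' e']]].
exists (r * 'X + r'%:P), (s * 'X + s'%:P); split.
- by apply: polyinD => //; [apply: polyinM => //; exact: polyinX|exact: polyinC].
- by apply: polyinD => //; [apply: polyinM => //; exact: polyinX|exact: polyinC].
by rewrite e e' polyCD !polyCM; ring.
Qed.

Lemma gauss_ext_maxgen R t x y : is_local R -> rtrans R t -> maxgen R x y ->
  maxgen (gauss_ext R t) x y.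
Proof.
move=> hl ht hm z; have hR := local_sub hl; have hP := adjm_prime hl ht.
have hA := adj_subring t hR; have hI := local_id (gauss_ext_local hl ht).
split; last first.
  move=> [r [s [Rr Rs ->]]].
  apply: (idD hI); apply: (idM hI) => //; apply: gauss_ext_nonunits => //.
    exact: maxgenl hm.
  exact: maxgenr hm.
move=> /(locat_nonunits _ hA hP) [_ [q [[p hp ->] Aq nq ->]]].
have [r [s [hr hs ->]]] := polyin_maxgen hR hm hp.
exists (r.[t] / q), (s.[t] / q); split.
- by exists r.[t], q; split=> //; exists r.
- by exists s.[t], q; split=> //; exists s.
by rewrite !hornerE; ring.
Qed.

Lemma gauss_ext_min R S t : is_local R -> is_local S -> incl R S -> S t ->
  (forall p, polyin R p -> nonunits S p.[t] -> polyin (nonunits R) p) ->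
  incl (gauss_ext R t) S.
Proof.
move=> hl hS RS St h _ [p [q [Ap [q' hq' eq] nq ->]]]; have hs := local_sub hS.
have Sp : S p by apply: adj_min Ap.
have Sq : S q by apply: (adj_min hs RS St); exists q'.
have [|_ ?] := @unit_inv F S q Sq; last by rin.
by move=> nu; apply: nq; exists q' => //; apply: h => //; rewrite -eq.
Qed.

End GaussExtension.

(** * The order valuation ring *)

Section OrderValuation.
Variables (F : fieldType) (R : F -> Prop) (x y : F).
Hypothesis hreg : reg R x y.
Hypothesis hq : is_quotient_field R.
Let hl : is_local R. Proof. by case: hreg. Qed.
Let hR : is_subring R. Proof. exact: local_sub hl. Qed.
Let hm : maxgen R x y. Proof. by case: hreg. Qed.
Let x0 : x != 0. Proof. exact: reg_neq0 hreg. Qed.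
Let t := y / x.
Let y0 : y != 0. Proof. exact: reg_neq0 (regC hreg). Qed.

Lemma order_rtrans : rtrans R (y / x).
Proof.
apply: residually_transcendental => //; first exact: reg_int_closed hq hreg.
  move=> Rt; case: hreg => _ _ _ /(_ 1%N) + _; apply; exists (y / x) => //.
  by rewrite expr1 divfK.
rewrite invf_div => Rt; case: hreg => _ _ _ _ /(_ 1%N); apply; exists (x / y) => //.
by rewrite expr1 divfK.
Qed.
Let ht := order_rtrans.
Let B := gauss_ext R t.
Let hBl : is_local B. Proof. exact: gauss_ext_local. Qed.
Let hB : is_subring B. Proof. exact: local_sub. Qed.

(** The maximal ideal is generated by [x] and [y], and [y = t x] with [t] in the ring. *)
Lemma order_dvd w : nonunits (gauss_ext R (y / x)) w -> dvdr (gauss_ext R (y / x)) x w.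
Proof.
have Bt : gauss_ext R (y / x) (y / x) by apply: gauss_ext_adj => //; apply: adj_gen.
move=> /(gauss_ext_maxgen hl ht hm) [r [s [Br Bs ->]]].
exists (r + s * (y / x)); first by rewrite -/t -/B in Br Bs Bt *; rin.
by field.
Qed.

(** The ring is a discrete valuation ring with uniformizer [x]. The two equations stand for
    nonnegative and nonpositive order, because exponents are natural numbers. *)
Lemma order_unit w : w != 0 -> exists i u, [/\ gauss_ext R (y / x) u,
  gauss_ext R (y / x) u^-1, u != 0 & w = u * x ^+ i \/ w * x ^+ i = u].
Proof.
rewrite -/t -/B => w0.
have nx : nonunits B x by apply: gauss_ext_nonunits => //; apply: maxgenl hm.
have hn : noetherian B by apply: gauss_ext_noetherian => //; case: hreg.
have dec a : R a -> a != 0 -> exists i u, [/\ B u, B u^-1, u != 0 & a = x ^+ i * u].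
  move=> Ra a0; have Ba : B a by apply: gauss_ext_sub.
  have [i [b [Bb nb e]]] := krull_intersection hBl hn nx Ba a0.
  have [b0 Bb'] : b != 0 /\ B b^-1 by apply: unit_inv => // /order_dvd.
  by exists i, b.
have [a [b [Ra [Rb [b0 e]]]]] := hq w.
have a0 : a != 0 by apply: contraNneq w0 => a0; rewrite e a0 mul0r.
have [i [u [Bu Bu' u0 ea]]] := dec a Ra a0.
have [j [v [Bv Bv' v0 eb]]] := dec b Rb b0.
case: (leqP j i) => [le|/ltnW le].
  exists (i - j)%N, (u / v); split; rin; rewrite ?invf_div ?mulf_neq0 ?invr_eq0 //; rin.
  have ei : x ^+ i = x ^+ (i - j) * x ^+ j by rewrite -exprD subnK.
  by left; rewrite e ea eb ei; field; rewrite v0 expf_neq0.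
exists (j - i)%N, (u / v); split; rin; rewrite ?invf_div ?mulf_neq0 ?invr_eq0 //; rin.
have ej : x ^+ j = x ^+ (j - i) * x ^+ i by rewrite -exprD subnK.
by right; rewrite e ea eb ej; field; rewrite v0 !expf_neq0.
Qed.

Lemma order_overring_valuation V : is_subring V -> incl (gauss_ext R (y / x)) V ->
  is_valuation_ring V.
Proof.
move=> hV BV; split=> // w w0; have [i [u [/BV Vu /BV Vu' u0 e]]] := order_unit w0.
have Vx : V x by apply: BV; apply: gauss_ext_sub => //; apply: nonunits_sub (maxgenl hR hm).
case: e => e; [left; rewrite e; rin|right].
have -> : w^-1 = u^-1 * x ^+ i by rewrite -e; field; rewrite w0 expf_neq0.
by rin.
Qed.

(** An element of negative order would, multiplied by a unit and a power of [x], give [x^-1]. So an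
    overring without [x^-1] adds nothing. *)
Lemma order_maximal V w : is_subring V -> incl (gauss_ext R (y / x)) V -> ~ V x^-1 -> V w ->
  gauss_ext R (y / x) w /\ (nonunits V w -> dvdr (gauss_ext R (y / x)) x w).
Proof.
rewrite -/t -/B => hV BV nVx Vw.
have Bx : B x by apply: gauss_ext_sub => //; apply: nonunits_sub (maxgenl hR hm).
case: (eqVneq w 0) => [->|w0]; first by split=> [|_]; [rin|exists 0; rin; rewrite mul0r].
have [i [u [Bu Bu' u0 e]]] := order_unit w0.
have eu : forall a, w = a * u -> a = 1 -> B w /\ (nonunits V w -> dvdr B x w).
  move=> a -> ->; rewrite mul1r; split=> // nu; case: (nonunits_inv u0 _ nu); exact: BV.
case: e => e; case: i e => [|i] e.
- by apply: (eu 1) => //; rewrite e expr0 mulr1 mul1r.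
- by split=> [|_]; rewrite e; [rin|exists (u * x ^+ i); rin; rewrite exprSr mulrA].
- by apply: (eu 1) => //; rewrite -e expr0 mulr1 mul1r.
case: nVx; have -> : x^-1 = w * x ^+ i * u^-1.
  by rewrite -e exprS; field; rewrite x0 w0 expf_neq0.
by have Vx := BV _ Bx; have Vu := BV _ Bu'; rin.
Qed.

End OrderValuation.

Section Division.
Variable F : fieldType.
Implicit Types (R P : F -> Prop) (f p q r : {poly F}).

Lemma monic_division R f p : is_subring R -> f \is monic -> polyin R f -> polyin R p ->
  exists h r, [/\ polyin R h, polyin R r, p = h * f + r & (size r < size f)%N].
Proof.
move=> hR mf hf; have [n] := ubnP (size p); elim: n p => // n IH p; rewrite ltnS => le_n hp.
case: (ltnP (size p) (size f)) => [lt|le].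
  by exists 0, p; split=> //; [exact: polyin0|rewrite mul0r add0r].
pose k := (size p - size f)%N.
have sf : (0 < size f)%N by rewrite size_poly_gt0 monic_neq0.
pose q := (lead_coef p)%:P * 'X^k.
have hq : polyin R q by apply: polyinM => //; [apply: polyinC => //; apply: hp|exact: polyinX_n].
have [||h [r [hh hr e lt]]] := IH (p - q * f).
- apply: leq_trans le_n; have sp : (0 < size p)%N by apply: leq_trans le.
  rewrite -(prednK sp) ltnS; apply/leq_sizeP => j lej.
  rewrite coefB /q -mulrA coefCM coefXnM.
  have -> : (j < k)%N = false.
    apply/negbTE; rewrite -leqNgt; apply: leq_trans lej; rewrite -ltnS prednK //.
    by rewrite -[X in (_ < X)%N](subnK le) -[X in (X < _)%N]addn0 ltn_add2l.
  move: lej; rewrite leq_eqVlt => /orP [/eqP <-|ltj].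
    have -> : ((size p).-1 - k = (size f).-1)%N.
      by rewrite -subn1 -subnDA addnC subnDA subKn ?subn1.
    by rewrite -!lead_coefE (monicP mf) mulr1 subrr.
  have spj : (size p <= j)%N by rewrite -(prednK sp).
  rewrite (nth_default 0 spj) nth_default ?mulr0 ?subr0 //.
  by rewrite leq_subRL ?subnK // (leq_trans (leq_subr _ _) spj).
- by apply: polyinD => //; apply: polyinN => //; apply: polyinM.
exists (h + q), r; split=> //; first exact: polyinD.
by rewrite mulrDl addrAC -e subrK.
Qed.

End Division.

(** * Local quadratic transforms *)

Section QuadraticTransform.
Variables (F : fieldType) (R : F -> Prop) (x y : F).
Hypothesis hreg : reg R x y.
Hypothesis hq : is_quotient_field R.
Let hl : is_local R. Proof. by case: hreg. Qed.
Let hR : is_subring R. Proof. exact: local_sub hl. Qed.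
Let hm : maxgen R x y. Proof. by case: hreg. Qed.
Let x0 : x != 0. Proof. exact: reg_neq0 hreg. Qed.
Local Notation t := (y / x).
Local Notation A := (adj R t).
Let hA : is_subring A. Proof. exact: adj_subring. Qed.
Let Ax : A x. Proof. by apply: adj_sub => //; exact: nonunits_sub (maxgenl hR hm). Qed.
Let At : A t. Proof. exact: adj_gen. Qed.
Let ht : rtrans R t. Proof. exact: order_rtrans hreg hq. Qed.

Lemma adjm_dvd w : adj (nonunits R) t w -> dvdr A x w.
Proof.
move=> [p hp ->]; have [r [s [hr hs ->]]] := polyin_maxgen hR hm hp.
exists (r.[t] + s.[t] * t); last by rewrite hornerD !hornerM !hornerC; field.
by have Ar : A r.[t] by [exists r]; have As : A s.[t] by [exists s]; rin.
Qed.

Section PrimeIdeal.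
Variable P : F -> Prop.
Hypothesis hP : is_prime_ideal A P.
Hypothesis Px : P x.
Hypothesis nPm : exists p : {poly F}, [/\ polyin R p, P p.[t] & ~ polyin (nonunits R) p].
Let hI : is_ideal A P. Proof. by case: hP. Qed.

Lemma adjm_sub_prime : incl (adj (nonunits R) t) P.
Proof. by move=> w /adjm_dvd [c Ac ->]; apply: (idM hI). Qed.

(** [f] lifts the monic generator of the image of [P] in polynomials over the residue field. A
    polynomial of least size having a unit coefficient and value in [P] has a unit leading
    coefficient, since a nonunit leading term has its value in [P] and could be dropped. *)
Lemma minimal_monic : exists f : {poly F}, [/\ f \is monic, polyin R f, P f.[t],
  (forall p, polyin R p -> P p.[t] -> (size p < size f)%N -> polyin (nonunits R) p) &
  (forall p, polyin R p -> P p.[t] ->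
     exists h r, [/\ polyin R h, polyin (nonunits R) r & p = h * f + r])].
Proof.
pose Q n := exists p : {poly F}, [/\ polyin R p, P p.[t], ~ polyin (nonunits R) p & size p = n].
have [|n [p [hp Ppt np en]] nmin] := @ex_minimal Q.
  by have [p [hp Pp np]] := nPm; exists (size p), p.
have pmin q : polyin R q -> P q.[t] -> (size q < n)%N -> polyin (nonunits R) q.
  move=> hq' Pq lt; apply: NNPP => nq; move: lt; rewrite ltnNge nmin //; by exists q.
set c := lead_coef p; have Rc : R c by apply: hp.
have p0 : p != 0.
  by apply/eqP => p0; apply: np; rewrite p0 => i; rewrite coef0; apply: nonunits0.
have nc : ~ nonunits R c.
  move=> nc; apply: np.
  have hI' := local_id hl.
  have hm' : polyin (nonunits R) (c%:P * 'X^((size p).-1)).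
    rewrite mulrC; apply: (polyin_idM hI'); first exact: polyinX_n.
    by move=> i; rewrite coefC; case: eqP => // _; apply: nonunits0.
  rewrite -[p](subrK (c%:P * 'X^((size p).-1))); apply: (polyin_idD hI') => //.
  apply: pmin.
  - apply: polyinD => //; apply: polyinN => //; apply: polyin_incl hm'; by move=> z [].
  - rewrite hornerD hornerN; apply: (idB hA hI) => //.
    by apply: adjm_sub_prime; exists (c%:P * 'X^((size p).-1)).
  - have sp : (0 < size p)%N by rewrite size_poly_gt0.
    rewrite -en -{2}(prednK sp) ltnS; apply/leq_sizeP => j.
    rewrite coefB coefCM coefXn leq_eqVlt => /orP [/eqP <-|ltj].
      by rewrite eqxx mulr1 subrr.
    by rewrite (gtn_eqF ltj) mulr0 subr0 nth_default // -(prednK sp).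
have [c0 Rc'] := unit_inv Rc nc.
have hf : polyin R (c^-1 *: p) by move=> i; rewrite coefZ; have ? := hp i; rin.
have mf : c^-1 *: p \is monic by rewrite monicE lead_coefZ mulVf.
have sf : size (c^-1 *: p) = n by rewrite size_scale ?invr_eq0.
have Pf : P (c^-1 *: p).[t].
  by rewrite hornerZ; apply: (idM hI) => //; apply: adj_sub.
exists (c^-1 *: p); split=> //; first by rewrite sf.
move=> q hq' Pq; have [h [r [hh hr e lt]]] := monic_division hR mf hf hq'.
exists h, r; split=> //; apply: pmin => //; last by rewrite -sf.
have -> : r = q - h * (c^-1 *: p) by rewrite e addrAC subrr add0r.
rewrite hornerD hornerN hornerM; apply: (idB hA hI) => //; apply: (idM hI) => //.
by exists h.
Qed.

Lemma monic_not_nonunits (f : {poly F}) : f \is monic -> ~ polyin (nonunits R) f.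
Proof. by move=> /monicP mf /(_ (size f).-1); rewrite -lead_coefE mf => /(nonunits1 hR). Qed.

Lemma quadratic_transform_maxgen (f : {poly F}) : P f.[t] ->
  (forall p, polyin R p -> P p.[t] ->
     exists h r, [/\ polyin R h, polyin (nonunits R) r & p = h * f + r]) ->
  maxgen (locat A P) x f.[t].
Proof.
move=> Pf fdiv z; have hL := locat_local hA hP; have hLs := local_sub hL.
split; last first.
  move=> [r [s [Lr Ls ->]]]; apply: (idD (local_id hL)); apply: (idM (local_id hL)) => //.
    apply/(locat_nonunits _ hA hP); exists x, 1; split; rin; rewrite ?divr1 //.
    by case: hP => _ [].
  apply/(locat_nonunits _ hA hP); exists f.[t], 1; split; rin; rewrite ?divr1 //.
  by case: hP => _ [].
move=> /(locat_nonunits _ hA hP) [p [q [Pp Aq nq ->]]].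
have [p' hp' ep] := id_sub hI Pp.
have [|h [r [hh hr e]]] := fdiv p' hp'; first by rewrite -ep.
have [|c Ac ec] := @adjm_dvd r.[t]; first by exists r.
exists (c / q), (h.[t] / q); split.
- by exists c, q.
- by exists h.[t], q; split=> //; exists h.
by rewrite ep e hornerD hornerM ec; ring.
Qed.

(** The parameters are [x] and [f.[t]]. By Gauss's lemma no power of [f] times a polynomial with a
    unit coefficient has its value in [xR[t]]. Conversely, if [f.[t]] divides [x ^+ n], Gauss's
    lemma makes the cofactor divisible by [x], and cancelling down to [n = 0] puts the denominator
    [q] in [P]. *)
Lemma quadratic_transform_regular : regular_local_dim2 (locat A P).
Proof.
have [f [mf hf Pf fmin fdiv]] := minimal_monic.
have nf := monic_not_nonunits mf.
have [_ [P1 _]] := hP.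
apply: (@reg_rlr _ _ x f.[t]); split.
- exact: locat_local.
- by apply: locat_noetherian => //; apply: adj_noetherian => //; case: hreg.
- exact: quadratic_transform_maxgen.
- move=> n [_ [p [q [Ap [q' hq' eq] nq ->]]] e].
  have q0 := prime_neq0 hP nq.
  have e' : (f ^+ n * q').[t] = p * x by rewrite hornerM horner_exp e -eq mulrAC divfK.
  have hfn : polyin R (f ^+ n).
    by elim: (n) => [|k IH]; rewrite ?expr0 ?exprS; [apply: polyinC; rin|apply: polyinM].
  have : polyin (nonunits R) (f ^+ n * q').
    apply: (rtrans_coef hl ht); first exact: polyinM.
    rewrite e'; apply: (idM (adj_ideal t (local_id hl))) => //.
    exists x%:P; rewrite ?hornerC // => i; rewrite coefC.
    by case: eqP => _; [exact: maxgenl hm|exact: nonunits0].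
  case/(gauss_nonunits hl hfn hq'); first by apply: monic_not_nonunits; apply: monic_exp.
  by move=> h; apply: nq; apply: adjm_sub_prime; exists q'.
- move=> n [_ [p [q [[p' hp' ->] Aq nq ->]]] e].
  have q0 := prime_neq0 hP nq.
  have {}e : x ^+ n * q = p'.[t] * f.[t] by rewrite e mulrAC divfK.
  elim: n p' hp' e => [|n IH] p' hp' e.
    by apply: nq; rewrite -[q]mul1r -(expr0 x) e; apply: (idM hI) => //; exists p'.
  have : polyin (nonunits R) (p' * f).
    apply: (rtrans_coef hl ht); first exact: polyinM.
    rewrite hornerM -e exprS -mulrA [x * _]mulrC; apply: (idM (adj_ideal t (local_id hl))); rin.
    exists x%:P; rewrite ?hornerC // => i; rewrite coefC.
    by case: eqP => _; [exact: maxgenl hm|exact: nonunits0].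
  case/(gauss_nonunits hl hp' hf) => // hp''.
  have [|c [c' hc ec] ep] := @adjm_dvd p'.[t]; first by exists p'.
  apply: (IH c' hc); apply: (mulfI x0); rewrite mulrA -exprS e ep ec; ring.
Qed.

End PrimeIdeal.

Section Dominated.
Variable S : F -> Prop.
Hypothesis hRS : LD R S.
Hypothesis St : S t.
Let hS : is_local S. Proof. by case: hRS. Qed.
Let hSs : is_subring S. Proof. exact: local_sub hS. Qed.
Let AS : incl A S. Proof. by apply: adj_min => //; case: hRS => _ []. Qed.

Definition center w : Prop := A w /\ nonunits S w.

Lemma center_prime : is_prime_ideal A center.
Proof.
have hI := local_id hS.
split.
  split; first by move=> w [].
  split; first by split; [rin|exact: nonunits0].
  split=> [u v [Au nu] [Av nv]|u v Au [Av nv]]; split; rin; first exact: (idD hI).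
  by apply: (idM hI) => //; apply: AS.
split; first by case=> _ /(nonunits1 hSs).
by move=> u v Au Av [_ /(nonunits_mul hS (AS Au) (AS Av)) []]; [left|right].
Qed.

Lemma center_x : center x.
Proof.
have nx := maxgenl hR hm; have [_ [_ dom]] := hRS.
by split=> //; apply/dom; first exact: nonunits_sub nx.
Qed.

(** The local quadratic transform of [R] along [S], in the chart where [y / x] belongs to [S]. *)
Definition transform : F -> Prop := locat A center.

Lemma transform_local : is_local transform.
Proof. exact: locat_local hA center_prime. Qed.

Lemma transform_sub : incl A transform.
Proof. by move=> w; apply: locat_sub hA center_prime. Qed.

Lemma transform_LD : LD transform S.
Proof.
have nS q : A q -> ~ center q -> q != 0 /\ S q^-1.
  by move=> Aq nq; apply: unit_inv; [exact: AS|move=> h; apply: nq].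
split=> //; split.
  move=> _ [p [q [Ap Aq nq ->]]]; have [_ ?] := nS q Aq nq; have ? := AS Ap; rin.
move=> w Tw; split; last first.
  move=> /(locat_nonunits _ hA center_prime) [p [q [[Ap np] Aq nq ->]]].
  by have [_ ?] := nS q Aq nq; apply: (idMr (local_id hS)).
have [p [q [Ap Aq nq ->]]] := Tw => nw; have [q0 _] := nS q Aq nq.
apply/(locat_nonunits _ hA center_prime); exists p, q; split=> //; split=> //.
by rewrite -[p](divfK q0); apply: (idMr (local_id hS)) => //; apply: AS.
Qed.

Lemma LD_transform : LD R transform.
Proof.
split; first exact: transform_local.
have RT : incl R transform by move=> w Rw; apply/transform_sub/adj_sub.
split=> // w Rw; have [_ [_ dom]] := hRS; have [_ [_ dom']] := transform_LD.
by split=> h; [apply/(dom w Rw)/(dom' w (RT w Rw))|apply/(dom' w (RT w Rw))/(dom w Rw)].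
Qed.

Lemma transform_dvd w : nonunits R w -> dvdr transform x w.
Proof.
move=> nw; have [|c Ac e] := @adjm_dvd w; last by exists c => //; apply: transform_sub.
by exists w%:P; rewrite ?hornerC // => i; rewrite coefC; case: eqP => // _; apply: nonunits0.
Qed.

End Dominated.

Lemma transform_cases S : LD R S -> S t ->
  incl (gauss_ext R t) S \/
  exists p : {poly F}, [/\ polyin R p, center S p.[t] & ~ polyin (nonunits R) p].
Proof.
move=> hRS St; have [hS [RS dom]] := hRS.
case: (classic (exists p : {poly F}, [/\ polyin R p, center S p.[t] & ~ polyin (nonunits R) p])).
  by right.
move=> hno; left; apply: gauss_ext_min => // p hp np; apply: NNPP => nnp; apply: hno.
by exists p; split=> //; split=> //; exists p.
Qed.

(* The center of [S] on [R[y/x]] is a maximal ideal generated by [x] and one more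
   element [f], so it is also the center of every [T] that does not contain [f^-1]. *)
Lemma transform_open S : LD R S -> S t ->
  (exists p : {poly F}, [/\ polyin R p, center S p.[t] & ~ polyin (nonunits R) p]) ->
  exists2 f, ~ S f^-1 &
    forall T, LD R T -> T t -> ~ T f^-1 -> incl (transform S) T.
Proof.
move=> hRS St nPm; have hP := center_prime hRS St.
have [f [mf hf Pf fmin fdiv]] := minimal_monic hP (center_x hRS) nPm.
have f0 : f.[t] != 0 by apply/eqP => /(ht hf); apply: monic_not_nonunits.
exists f.[t]; first by move=> h; have [_ nf] := Pf; apply: nonunits_inv h nf.
move=> T hRT Tt nTf; have hP' := center_prime hRT Tt; have [hI [P1 pP]] := hP.
have AT : incl A T by apply: adj_min => //; [case: hRT => /local_sub|case: hRT => _ []].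
have nf : nonunits T f.[t].
  have Tf : T f.[t] by apply: AT; exists f.
  by apply: NNPP => /(unit_inv Tf) [].
have [hI' [P1' pP']] := hP'.
have nPm' : exists p : {poly F}, [/\ polyin R p, center T p.[t] & ~ polyin (nonunits R) p].
  exists f; split=> //; first by split=> //; exists f.
  exact: monic_not_nonunits.
have [g [mg hg Pg gmin gdiv]] := minimal_monic hP' (center_x hRT) nPm'.
suff sub : incl (center T) (center S).
  move=> _ [p [q [Ap Aq nq ->]]].
  have [|_ ?] := @unit_inv F T q (AT _ Aq); first by move=> h; apply: nq; apply: sub.
  by have hT : is_subring T by [case: hRT => /local_sub]; have ? := AT _ Ap; rin.
(* Over the residue field [g] divides [f], with cofactor [h]. As [g] is not constant, [h] is smaller
   than [f]; if its value lay in the center of [S], minimality of [f] would make all coefficients of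
   [h], hence of [f], nonunits. So the value of [g] lies there. *)
have [h [r [hh hr e lt]]] := monic_division hR mg hg hf.
have Pr : center T r.[t].
  have -> : r.[t] = f.[t] - h.[t] * g.[t] by rewrite e hornerD hornerM addrC addKr.
  apply: (idB hA hI'); first by split=> //; exists f.
  by apply: (idM hI') => //; exists h.
have {Pr} hrm := gmin r hr Pr lt.
have hgS : center S g.[t].
  have hAm r' : polyin (nonunits R) r' -> center S r'.[t].
    by move=> hr'; apply: (adjm_sub_prime hP (center_x hRS)); exists r'.
  have [|||Ph|//] := pP h.[t] g.[t]; [by exists h|by exists g| | ].
    have -> : h.[t] * g.[t] = f.[t] - r.[t] by rewrite e hornerD hornerM addrK.
    by apply: (idB hA hI) => //; apply: hAm.
  suff lth : (size h < size f)%N.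
    have hhm := fmin h hh Ph lth; case: (monic_not_nonunits mf); rewrite e.
    apply: (polyin_idD (local_id hl)) => //.
    by rewrite mulrC; apply: (polyin_idM (local_id hl)).
  have le : (size g <= size f)%N.
    rewrite leqNgt; apply/negP => lt'; apply: (monic_not_nonunits mf); apply: gmin => //.
    by split=> //; exists f.
  have h0 : h != 0.
    apply/eqP => h0; apply: (monic_not_nonunits mf).
    by rewrite e h0 mul0r add0r.
  have sg : (1 < size g)%N.
    rewrite ltnNge; apply/negP => /size1_polyC eg; apply: P1'.
    by move: mg Pg; rewrite eg monicE lead_coefC hornerC => /eqP ->.
  have -> : size f = size (h * g).
    have -> : h * g = f - r by rewrite e addrK.
    by rewrite size_polyDl // size_polyN (leq_trans lt).
  rewrite size_Mmonic //; case: (size g) sg => [|[|k]] // _; by rewrite !addnS /= ltnS leq_addr.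
move=> w Pw; have [p hp ep] := id_sub hI' Pw.
have [|h' [r' [hh' hr' e']]] := gdiv p hp; first by rewrite -ep.
rewrite ep e' hornerD hornerM; apply: (idD hI).
  by apply: (idM hI) => //; exists h'.
by apply: (adjm_sub_prime hP (center_x hRS)); exists r'.
Qed.

End QuadraticTransform.

Section Domination.
Variable F : fieldType.
Implicit Types (R S T : F -> Prop).

Lemma LD_refl R : is_local R -> LD R R.
Proof. by move=> hl; split=> //; split. Qed.

Lemma LD_trans R S T : LD R S -> LD S T -> LD R T.
Proof.
move=> [_ [RS d1]] [hT [ST d2]]; split=> //; split; first by move=> w /RS /ST.
by move=> w Rw; split=> h; [apply/(d1 _ Rw)/(d2 _ (RS _ Rw))|apply/(d2 _ (RS _ Rw))/(d1 _ Rw)].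
Qed.

Lemma quotient_field_incl R S : incl R S -> is_quotient_field R -> is_quotient_field S.
Proof.
move=> RS hq x; have [a [b [Ra [Rb [b0 e]]]]] := hq x.
by exists a, b; split; [exact: RS|split; [exact: RS|]].
Qed.

End Domination.

(** * Unions of chains of local rings under domination *)

Section Union.
Variables (F : fieldType) (E : nat -> F -> Prop).
Hypothesis hE : forall n, is_local (E n).
Hypothesis hLD : forall n, LD (E n) (E n.+1).

Definition union w : Prop := exists n, E n w.

Lemma union_LD_le m n : (m <= n)%N -> LD (E m) (E n).
Proof.
move=> /subnK <-; elim: (n - m)%N => [|k IH]; first exact: LD_refl.
exact: LD_trans IH (hLD _).
Qed.

Lemma union_incl_le m n : (m <= n)%N -> incl (E m) (E n).
Proof. by move=> /union_LD_le [_ []]. Qed.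

Lemma union_pair u v : union u -> union v -> exists n, E n u /\ E n v.
Proof.
move=> [m Eu] [n Ev]; exists (maxn m n).
by split; [apply: union_incl_le Eu; rewrite leq_maxl|apply: union_incl_le Ev; rewrite leq_maxr].
Qed.

Lemma union_subring : is_subring union.
Proof.
have hs n := local_sub (hE n).
split; first by exists 0%N; apply: (sr0 (hs _)).
split; first by exists 0%N; apply: (sr1 (hs _)).
split.
  by move=> u v hu hv; have [n [Eu Ev]] := union_pair hu hv; exists n; apply: (srD (hs n)).
split; first by move=> u [n Eu]; exists n; apply: (srN (hs n)).
by move=> u v hu hv; have [n [Eu Ev]] := union_pair hu hv; exists n; apply: (srM (hs n)).
Qed.

Lemma union_nonunits n w : E n w -> (nonunits union w <-> nonunits (E n) w).
Proof.
move=> Ew; split=> -[_ nu]; split=> //.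
    by move=> [v [Ev e]]; apply: nu; exists v; split=> //; exists n.
  by exists n.
move=> [v [[m Ev] e]].
have le1 : (n <= maxn n m)%N by rewrite leq_maxl.
have [_ [_ dom]] := union_LD_le le1.
have nw : nonunits (E (maxn n m)) w by apply/dom.
apply: (nonunitsN1 nw _ e).
by apply: union_incl_le Ev; rewrite leq_maxr.
Qed.

Lemma union_local : is_local union.
Proof.
split; first exact: union_subring.
split; first by move=> w [].
split; first exact: nonunits0 union_subring.
split.
  move=> u v nu nv; have [n [Eu Ev]] := union_pair (nonunits_sub nu) (nonunits_sub nv).
  have Euv : E n (u + v) by apply: (srD (local_sub (hE n))).
  by apply/(union_nonunits Euv); apply: (idD (local_id (hE n))); apply/union_nonunits.
move=> r v hr nv; have [n [Er Ev]] := union_pair hr (nonunits_sub nv).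
have Erv : E n (r * v) by apply: (srM (local_sub (hE n))).
by apply/(union_nonunits Erv); apply: (idM (local_id (hE n))) => //; apply/union_nonunits.
Qed.

Lemma union_LD n : LD (E n) union.
Proof.
split; first exact: union_local.
by split; [move=> w Ew; exists n|move=> w; apply: union_nonunits].
Qed.

Lemma union_int_closed : (forall n, int_closed (E n)) -> int_closed union.
Proof.
move=> hic c n d hd e.
have [N hN] : exists N, forall i, (i < n)%N -> E N (d i).
  elim: n {e} => [|n [N hN]]; first by exists 0%N.
  have [m Em] := hd n; exists (maxn m N) => i; rewrite ltnS leq_eqVlt => /orP [/eqP ->|lt].
    by apply: union_incl_le Em; rewrite leq_maxl.
  by apply: (union_incl_le _ (hN i lt)); rewrite leq_maxr.
(* Only the first [n] coefficients occur in the equation. The others are replaced by 0, because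
   [int_closed] asks that the whole sequence lie in one ring. *)
exists N; apply: (hic N c n (fun i => if (i < n)%N then d i else 0)).
  by move=> i; case: ifP => [/hN //|_]; apply: (sr0 (local_sub (hE N))).
by rewrite e; apply: eq_bigr => i _; rewrite ltn_ord.
Qed.

End Union.

(** * Krull-Akizuki and Abhyankar's union theorem *)

Lemma dvdr_exp (F : fieldType) (R : F -> Prop) a b n : is_subring R -> dvdr R a b ->
  dvdr R (a ^+ n) (b ^+ n).
Proof. by move=> hR [c Rc ->]; exists (c ^+ n); rin; rewrite exprMn. Qed.

(* Kaplansky's form of the Krull-Akizuki argument: [W] lies in [b^-n B + b W] for some [n],
   hence [W/bW] has finite length over [B], and the ideals [X_i W], all of which contain [b],
   cannot decrease strictly. *)
Lemma krull_akizuki (F : fieldType) (B W : F -> Prop) (b : F) (X : nat -> F) :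
  is_subring B -> is_subring W -> incl B W -> B b -> b != 0 ->
  (forall k, dcc B B (dvdr B (b ^+ k))) ->
  (forall w, W w -> exists j, B (b ^+ j * w)) ->
  (forall i, W (X i) /\ dvdr W (X i) b) -> (forall i, dvdr W (X i) (X i.+1)) ->
  exists i, dvdr W (X i.+1) (X i).
Proof.
move=> hB hW BW Bb b0 hdcc hWB hX Xdec; have Wb := BW _ Bb.
pose I k v := B v /\ exists w v1, [/\ W w, B v1 & v = b ^+ k * w + b * v1].
have Idec k : incl (I k.+1) (I k).
  move=> u [Bu [w [v1 [Ww Bv1 eu]]]]; split=> //; exists (b * w), v1; split; rin.
  by rewrite eu exprS; ring.
have [|//|||n hn] := hdcc 1%N I.
- move=> k; split; first by move=> z [].
  split; first by split; rin; exists 0, 0; split; rin; ring.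
  split.
    move=> u v [Bu [w [v1 [Ww Bv1 eu]]]] [Bv [w' [v1' [Ww' Bv1' ev]]]].
    by split; rin; exists (w + w'), (v1 + v1'); split; rin; rewrite eu ev; ring.
  move=> r v Br [Bv [w [v1 [Ww Bv1 ev]]]].
  by split; rin; have ? := BW _ Br; exists (r * w), (r * v1); split; rin; rewrite ev; ring.
- move=> k _ [c Bc ->]; split; first by rewrite expr1; rin.
  by exists 0, c; split; rin; rewrite expr1; ring.
- by move=> k z [].
have claim w : W w -> exists v w', [/\ B v, W w' & b ^+ n * w = v + b ^+ n.+1 * w'].
  move=> Ww; have [j Bj] := hWB w Ww.
  (* Descent on the exponent, trivial for [j] large. Stability of the ideals [I k] makes [v] a
     multiple of [b] in [B] up to a multiple in [W] of a higher power of [b], so one factor [b]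
     cancels. *)
  have : exists v w', [/\ B v, W w' & b ^+ (j + n) * w = v + b ^+ (j + n).+1 * w'].
    exists (b ^+ n * (b ^+ j * w)), 0; split; rin; by rewrite exprD; ring.
  elim: j {Bj} => [//|j IH] [v [w' [Bv Ww' e]]]; apply: IH.
  have Iv : I (j.+1 + n)%N v.
    split=> //; exists (w - b * w'), 0; split; rin.
    have -> : v = b ^+ (j.+1 + n) * w - b ^+ (j.+1 + n).+1 * w' by rewrite e; ring.
    by rewrite exprS; ring.
  have In : I n v.
    by apply: (decreasing_le Idec) Iv; rewrite leq_addl.
  have le : (n <= (j.+1 + n).+1)%N by rewrite leqW // leq_addl.
  have [_ [w2 [v2 [Ww2 Bv2 ev]]]] := hn _ le v In.
  exists v2, (w2 + w'); split; rin.
  apply: (mulfI b0); transitivity (b ^+ (j.+1 + n) * w); first by rewrite addSn exprS mulrA.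
  by rewrite e ev addSn !exprS; ring.
(* The factor [b ^+ n] makes room for denominators: the claim writes [b ^+ n * X i] as an element of
   [K i] plus a multiple of [b ^+ n.+1]. Each [K i] contains [b ^+ n.+1 B] because [X i] divides [b]
   in [W]. *)
pose K i v := B v /\ exists2 w, W w & v = b ^+ n * X i * w.
have WX i : W (X i) by case: (hX i).
have [||||i hi] := hdcc n.+1 K.
- move=> k; split; first by move=> z [].
  split; first by split; rin; exists 0; rin; ring.
  split=> [u v [Bu [w Ww eu]] [Bv [w' Ww' ev]]|r v Br [Bv [w Ww ev]]].
    by split; rin; exists (w + w'); rin; rewrite eu ev; ring.
  by split; rin; have ? := BW _ Br; exists (r * w); rin; rewrite ev; ring.
- move=> k u [Bu [w Ww eu]]; split=> //; have [c Wc ec] := Xdec k.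
  by exists (c * w); rin; rewrite eu ec; ring.
- move=> k _ [c Bc ->]; split; first by rin.
  have [_ [d Wd ed]] := hX k; have ? := BW _ Bc; exists (c * d); rin.
  have -> : b ^+ n.+1 = b ^+ n * (d * X k) by rewrite -ed exprSr.
  by ring.
- by move=> k z [].
exists i; have [v [w' [Bv Ww' e]]] := claim _ (WX i).
have [_ [d Wd ed]] := hX i; have [_ [d' Wd' ed']] := hX i.+1.
have Ki : K i v.
  split=> //; exists (1 - d * w'); rin.
  have -> : v = b ^+ n * X i - b ^+ n.+1 * w' by rewrite e; ring.
  have -> : b ^+ n.+1 = b ^+ n * (d * X i) by rewrite -ed exprSr.
  by ring.
have [_ [w2 Ww2 ev]] := hi i.+1 (leqnSn i) v Ki.
exists (w2 + d' * w'); rin.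
apply: (mulfI (expf_neq0 n b0)); rewrite e ev.
have -> : b ^+ n.+1 = b ^+ n * (d' * X i.+1) by rewrite -ed' exprSr.
by ring.
Qed.

(* Abhyankar: an infinite sequence of local quadratic transforms has a valuation ring as union.
   If neither [z] nor [z^-1] is in the union [S], then [z] is residually transcendental over
   [S]; in [B = E_0(z)] the numerator and denominator of [z] generate a principal ideal
   primary to the maximal ideal, while the denominator is divisible in [S(z)] by all the
   products [x_0 ... x_n]. *)
Lemma quadratic_sequence (F : fieldType) (E : nat -> F -> Prop) (e : nat -> F) z :
  (forall n, regular_local_dim2 (E n)) -> (forall n, LD (E n) (E n.+1)) ->
  (forall n, nonunits (E n) (e n)) ->
  (forall n w, nonunits (E n) w -> dvdr (E n.+1) (e n) w) ->
  is_quotient_field (E 0%N) -> exists n, E n z \/ E n z^-1.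
Proof.
move=> hE hLD hx hdvd hq.
have hl n : is_local (E n) by case: (hE n).
have hs n := local_sub (hl n).
have [x [y hm]] := rlr_maxgen (hE 0%N); have hreg := rlr_reg (hE 0%N) hm.
have qE n : is_quotient_field (E n).
  by apply: quotient_field_incl hq; apply: union_incl_le.
have hic : int_closed (union E).
  apply: union_int_closed => // n; have [x' [y' hm']] := rlr_maxgen (hE n).
  exact: reg_int_closed (qE n) (rlr_reg (hE n) hm').
have hS := union_local hl hLD.
apply: NNPP => hno.
have nz : ~ union E z by move=> [n h]; apply: hno; exists n; left.
have nz' : ~ union E z^-1 by move=> [n h]; apply: hno; exists n; right.
have htS := residually_transcendental hS hic nz nz'.
have ht := rtrans_incl (union_LD hl hLD 0%N) htS.
have [a0 [b0 [Ra0 [Rb0 [b00 ez]]]]] := hq z.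
have [a [b [N [Ra Rb bn0 eab [hNx hNy]]]]] := coprime_fraction hreg Ra0 Rb0 b00.
have {ez eab} ez : z = a / b by rewrite ez eab.
pose X n := \prod_(i < n) e i.
have EX n : union E (X n).
  elim: n => [|n IH]; rewrite /X; first by rewrite big_ord0; apply: (sr1 (local_sub hS)).
  rewrite big_ord_recr; apply: (srM (local_sub hS)) => //; exists n; exact: nonunits_sub.
(* A unit among [a'], [b'] would put [z] or [z^-1] in [E n]. So both are nonunits, and both become
   divisible by [e n] in the next ring. *)
have ab n : exists a' b', [/\ E n a', E n b', a = X n * a' & b = X n * b'].
  elim: n => [|n [a' [b' [Ea Eb ea eb]]]].
    by exists a, b; rewrite /X big_ord0 !mul1r.
  have X0 : X n != 0 by apply: contraNneq bn0 => h; rewrite eb h mul0r.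
  have b'0 : b' != 0 by apply: contraNneq bn0 => h; rewrite eb h mulr0.
  have na : nonunits (E n) a'.
    apply: NNPP => /(unit_inv Ea) [a'0 ?]; apply: nz'; exists n.
    have -> : z^-1 = b' * a'^-1 by rewrite ez ea eb; field; rewrite X0 b'0 a'0.
    exact: (srM (hs n)).
  have nb : nonunits (E n) b'.
    apply: NNPP => /(unit_inv Eb) [_ ?]; apply: nz; exists n.
    have -> : z = a' * b'^-1 by rewrite ez ea eb; field; rewrite X0 b'0.
    exact: (srM (hs n)).
  have [a1 Ea1 ea1] := hdvd n _ na; have [b1 Eb1 eb1] := hdvd n _ nb.
  exists a1, b1; split=> //; rewrite /X big_ord_recr -/(X n) /=.
    by rewrite ea ea1; ring.
  by rewrite eb eb1; ring.
pose B := gauss_ext (E 0%N) z; pose W := gauss_ext (union E) z.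
have hBl : is_local B by apply: gauss_ext_local.
have hWl : is_local W by apply: gauss_ext_local.
have hB := local_sub hBl; have hW := local_sub hWl.
have hBm : maxgen B x y by apply: gauss_ext_maxgen.
have Bz : B z by apply: gauss_ext_adj => //; apply: adj_gen.
have EB w : E 0%N w -> B w by move=> Ew; apply: gauss_ext_sub.
have SW w : union E w -> W w by move=> Ew; apply: gauss_ext_sub.
have nb : nonunits B b.
  apply: gauss_ext_nonunits => //; apply: NNPP => /(unit_inv Rb) [_ ?].
  by apply: nz; exists 0%N; rewrite ez; apply: (srM (hs _)).
have dvdb w : ideal2 (E 0%N) a b w -> dvdr B b w.
  move=> [r [s [Er Es ->]]]; have ? := EB _ Er; have ? := EB _ Es.
  by exists (r * z + s); rin; rewrite ez; field.
have dccB k : dcc B B (dvdr B (b ^+ k)).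
  have Bb := nonunits_sub nb.
  have Bx := nonunits_sub (maxgenl hB hBm); have By := nonunits_sub (maxgenr hB hBm).
  have hI : is_ideal B (dvdr B (b ^+ k)) by apply: dvdr_ideal; rin.
  have hxy w i : B w -> dvdr B b (w ^+ N) -> (N * k <= i)%N -> dvdr B (b ^+ k) (w ^+ i).
    move=> Bw hw /subnK <-; rewrite exprD; apply: (idM hI); first by rin.
    by rewrite exprM; apply: dvdr_exp.
  (* In a monomial of this degree one of the exponents is at least [N * k], and [b ^+ k] divides
     that power. *)
  apply: (dcc_mod (j := (N * k + N * k)%N) hBl hBm hI) => i l eil.
  case: (leqP (N * k) i) => [le|lt].
    by apply: (idMr hI); rin; apply: hxy => //; apply: dvdb.
  apply: (idM hI); rin; apply: hxy => //; first exact: dvdb.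
  by rewrite -(leq_add2l (N * k)) -eil leq_add2r ltnW.
(* The denominator of [w] over [E 0] divides a power of [b] in [B], by [power_dvd]. *)
have hWB w : W w -> exists j, B (b ^+ j * w).
  move=> _; have [c [d [Ec [Ed [d0 ->]]]]] := hq w.
  have hd : dcc B B (dvdr B b) by rewrite -(expr1 b).
  have hn : noetherian B by apply: gauss_ext_noetherian => //; case: hreg.
  have [j [v Bv ej]] := power_dvd hBl hn nb hd (EB _ Ed) d0.
  exists j; rewrite ej mulrA mulrAC mulfK //; have ? := EB _ Ec; rin.
have BW : incl B W by apply: gauss_ext_incl => //; apply: union_LD.
have [||i [w Ww ew]] := krull_akizuki hB hW BW (nonunits_sub nb) bn0 dccB hWB (X := X).
- move=> i; split; first exact: SW.
  have [_ [b' [_ Eb _ eb]]] := ab i; exists b'; last by rewrite eb mulrC.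
  by apply: SW; exists i.
- move=> i; exists (e i); last by rewrite /X big_ord_recr mulrC.
  by apply: SW; exists i; apply: nonunits_sub.
have X0 : X i != 0.
  by have [_ [b' [_ _ _ eb]]] := ab i; apply: contraNneq bn0 => h; rewrite eb h mul0r.
(* Divisibility of [X i] by [X i.+1 = X i * e i] makes [e i] a unit of [W], although it is a nonunit
   of [E i]. *)
have nW : nonunits W (e i).
  apply: gauss_ext_nonunits => //; apply/(union_nonunits hl hLD (n := i)) => //.
  exact: nonunits_sub.
apply: (nonunitsN1 nW Ww); apply: (mulIf X0).
by rewrite mul1r [RHS]ew /X big_ord_recr /=; ring.
Qed.

Lemma reg_not_valuation (F : fieldType) (R : F -> Prop) x y : reg R x y -> ~ is_valuation_ring R.
Proof.
move=> hreg [_ hv]; have x0 := reg_neq0 hreg; have y0 := reg_neq0 (regC hreg).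
case: hreg => _ _ _ hyx hxy.
have t0 : y / x != 0 by rewrite mulf_neq0 ?invr_neq0.
have [Rt|Rt] := hv _ t0; first by apply: (hyx 1%N); exists (y / x); rewrite ?expr1 ?divfK.
by rewrite invf_div in Rt; apply: (hxy 1%N); exists (x / y); rewrite ?expr1 ?divfK.
Qed.

(** * Regular local rings between [D] and its quotient field *)

Section RegularOverrings.
Variables (F : fieldType) (D : F -> Prop) (x y : F).
Hypothesis hreg : reg D x y.
Hypothesis hq : is_quotient_field D.
Let hl : is_local D. Proof. by case: hreg. Qed.
Let hD : is_subring D. Proof. exact: local_sub hl. Qed.
Let hm : maxgen D x y. Proof. by case: hreg. Qed.
Let x0 : x != 0. Proof. exact: reg_neq0 hreg. Qed.

(* If the center of [S] on [D] were smaller than the maximal ideal, it would be principal,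
   and [S] would contain the valuation ring obtained by localizing [D] at it. *)
Lemma QD_LD S : QD D S -> LD D S.
Proof.
move=> [hS DS]; have [hSl _] := hS; have hSs := local_sub hSl; have hI := local_id hSl.
pose P w := D w /\ nonunits S w.
have hP : is_prime_ideal D P.
  split.
    split; first by move=> w [].
    split; first by split; [rin|exact: nonunits0].
    split=> [u v [Au nu] [Av nv]|u v Au [Av nv]]; split; rin; first exact: (idD hI).
    by apply: (idM hI) => //; apply: DS.
  split; first by case=> _ /(nonunits1 hSs).
  by move=> u v Au Av [_ /(nonunits_mul hSl (DS _ Au) (DS _ Av)) []]; [left|right].
have [hPI [P1 _]] := hP.
case: (reg_primes hreg hP) => [[g Pg gP]|sub]; last first.
  split=> //; split=> // w Dw; split=> [nw|/sub []] //.
  by apply: NNPP => /(unit_inv Dw) [w0 /DS]; move/(nonunits_inv w0).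
have [x' [y' hmS]] := rlr_maxgen hS.
case: (reg_not_valuation (rlr_reg hS hmS)); split=> // w w0.
have ng := proper_sub_nonunits hPI P1 Pg.
have Sg : S g by apply: DS; apply: nonunits_sub ng.
have dec a : D a -> a != 0 -> exists i u, [/\ S u, S u^-1, u != 0, g ^+ i != 0 & a = g ^+ i * u].
  move=> Da a0; have [|i [b [Db nb e]]] := krull_intersection hl _ ng Da a0; first by case: hreg.
  have [b0 Sb'] : b != 0 /\ S b^-1.
    by apply: unit_inv; [exact: DS|move=> h; apply: nb; apply: gP].
  exists i, b; split=> //; first exact: DS.
  by apply: contraNneq a0 => h; rewrite e h mul0r.
have [a [b [Da [Db [b0 e]]]]] := hq w.
have a0 : a != 0 by apply: contraNneq w0 => a0; rewrite e a0 mul0r.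
have [i [c [Sc Sc' c0 gi ea]]] := dec a Da a0.
have [j [d [Sd Sd' d0 gj eb]]] := dec b Db b0.
case: (leqP j i) => [le|/ltnW le]; [left|right].
  have ei : g ^+ i = g ^+ (i - j) * g ^+ j by rewrite -exprD subnK.
  have -> : w = g ^+ (i - j) * c * d^-1 by rewrite e ea eb ei; field; rewrite d0 gj.
  by rin.
have ej : g ^+ j = g ^+ (j - i) * g ^+ i by rewrite -exprD subnK.
have gk : g ^+ (j - i) != 0 by apply: contraNneq gj => h; rewrite ej h mul0r.
have -> : w^-1 = g ^+ (j - i) * d * c^-1 by rewrite e ea eb ej; field; rewrite d0 gi c0 gk.
by rin.
Qed.

(* If neither quotient of the parameters is in [S], then [S] and [D] have the same Gauss
   extension by [y/x], the order valuation ring of [D].  Were the matrix expressing [x, y] in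
   parameters [u, v] of [S] singular modulo the maximal ideal of [S], it would vanish modulo
   that ideal, and [x] would have order at least [2].  So [x, y] generate the maximal ideal
   of [S], and a reduced fraction in [S] has unit denominator. *)
Lemma QD_eq S : QD D S -> ~ S (y / x) -> ~ S (x / y) -> incl S D.
Proof.
move=> hSD nt nt'; have hLD := QD_LD hSD; have [hS DS] := hSD.
have [hSl _] := hS; have hSs := local_sub hSl.
have qS := quotient_field_incl DS hq.
have [u [v hmS]] := rlr_maxgen hS; have hregS := rlr_reg hS hmS.
pose t := y / x.
have htS : rtrans S t.
  apply: residually_transcendental => //; first exact: reg_int_closed qS hregS.
  by rewrite invf_div.
pose W := gauss_ext S t.
have hWl : is_local W by apply: gauss_ext_local.
have hW := local_sub hWl; have hWI := local_id hWl.
have SW w : S w -> W w by apply: gauss_ext_sub.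
have Wt : W t by apply: gauss_ext_adj => //; apply: adj_gen.
have BW : incl (gauss_ext D t) W by apply: gauss_ext_incl.
have Dx := nonunits_sub (maxgenl hD hm); have Dy := nonunits_sub (maxgenr hD hm).
have [_ [_ dom]] := hLD.
have nSx : nonunits S x by apply/dom => //; apply: maxgenl hm.
have nSy : nonunits S y by apply/dom => //; apply: maxgenr hm.
have nWx : nonunits W x by apply: gauss_ext_nonunits.
have dvdW w : nonunits S w -> exists2 c, W c & w = c * x.
  move=> nw; have nVx h := nonunits_inv x0 h nWx.
  have [_ h] := order_maximal hreg hq hW BW nVx (SW _ (nonunits_sub nw)).
  by have [|c /BW Wc e] := h; [exact: gauss_ext_nonunits|exists c].
have [r [s [Sr Ss ex]]] : exists r s, [/\ S r, S s & x = r * u + s * v] by apply/hmS.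
have [r' [s' [Sr' Ss' ey]]] : exists r s, [/\ S r, S s & y = r * u + s * v] by apply/hmS.
pose de := r * s' - r' * s.
have Sde : S de by rewrite /de; rin.
have [u1 Wu1 eu] := dvdW _ (maxgenl hSs hmS); have [v1 Wv1 ev] := dvdW _ (maxgenr hSs hmS).
have nde : ~ nonunits S de.
  move=> /dvdW [c Wc ec].
  (* A coefficient of a linear form in [t] with value in [xW] is a nonunit. It is applied to
     [s' x - s y = de u] and [r' x - r y = - de v] (Cramer), divided by [x]. *)
  have lin p q w : S p -> S q -> W w -> p - q * t = w * x -> nonunits S q.
    move=> Sp Sq Ww e.
    have hpq : polyin S (p%:P - q%:P * 'X).
      apply: polyinD => //; first exact: polyinC.
      by apply: polyinN => //; apply: polyinM => //; [exact: polyinC|exact: polyinX].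
    have := @gauss_ext_coef _ S t _ hSl htS hpq.
    rewrite hornerD hornerN hornerM !hornerC hornerX e => /(_ (idM hWI Ww nWx) 1%N).
    rewrite coefB coefC coefCM coefX /= mulr1 sub0r => h.
    by rewrite -[q]opprK; apply: (idN hSs (local_id hSl)).
  have /dvdW [s1 Ws1 es] : nonunits S s.
    apply: (lin s' s (c * u1)) => //; first by rin.
    apply: (mulIf x0); transitivity (de * u).
      by rewrite mulrBl -mulrA divfK // ey {1}ex /de; ring.
    by rewrite ec eu; ring.
  have /dvdW [r1 Wr1 er] : nonunits S r.
    apply: (lin r' r (- (c * v1))) => //; first by rin.
    apply: (mulIf x0); transitivity (- (de * v)).
      by rewrite mulrBl -mulrA divfK // ey {1}ex /de; ring.
    by rewrite ec ev; ring.
  have Wz : W (r1 * u1 + s1 * v1) by rin.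
  apply: (nonunitsN1 nWx Wz); apply: (mulIf x0).
  by rewrite mul1r [RHS]ex er es eu ev; ring.
have [de0 Sde'] := unit_inv Sde nde.
have hmxy : maxgen S x y.
  move=> z; split=> [/hmS [p [q [Sp Sq ->]]]|[p [q [Sp Sq ->]]]]; last first.
    by apply: (idD (local_id hSl)); apply: (idM (local_id hSl)).
  exists (de^-1 * (p * s' - q * r')), (de^-1 * (q * r - p * s)); split; rin.
  have -> : p * u + q * v = de^-1 * (de * (p * u + q * v)) by rewrite mulKf.
  by rewrite -!mulrA -mulrDr; congr (_ * _); rewrite ey {1}ex /de; ring.
have hregxy := rlr_reg hS hmxy.
move=> c Sc; have [a0 [b0 [Da0 [Db0 [b00 ec]]]]] := hq c.
have [a [b [N [Da Db bn0 eab [hNx hNy]]]]] := coprime_fraction hreg Da0 Db0 b00.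
have {eab} ec : c = a / b by rewrite ec eab.
have dvdb w : ideal2 D a b w -> dvdr S b w.
  move=> [p [q [/DS Sp /DS Sq ->]]].
  by exists (p * c + q); rin; rewrite ec; field.
have nb := reg_unit hregxy (DS _ Db) (dvdb _ hNx) (dvdb _ hNy).
have [_ Db'] : b != 0 /\ D b^-1 by apply: unit_inv => // /(dom _ Db).
by rewrite ec; rin.
Qed.

(** Splits according to the center of [S] on [D[y/x]]. The element [f] makes containment of the
    transform testable by two membership conditions, which is what a patch neighbourhood can
    express. *)
Lemma quadratic_step S : LD D S -> S (y / x) ->
  incl (gauss_ext D (y / x)) S \/
  exists R f, [/\ regular_local_dim2 R, LD D R, LD R S,
    (forall w, nonunits D w -> dvdr R x w) &
    ~ S f^-1 /\ forall T, LD D T -> T (y / x) -> ~ T f^-1 -> incl R T].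
Proof.
move=> hLD St; case: (transform_cases hreg hLD St) => [|nPm]; first by left.
right; have [f nSf hf] := transform_open hreg hq hLD St nPm.
exists (transform D x y S), f; split=> //.
- apply: (quadratic_transform_regular hreg hq _ _ nPm); first exact: center_prime.
  exact: center_x.
- exact: (LD_transform hreg hLD St).
- exact: (transform_LD hreg hLD St).
- by move=> w; apply: transform_dvd.
Qed.

End RegularOverrings.

(** If a product lies in a proper ideal that contains neither factor, adjoining the first factor
    keeps the ideal proper; this growth must stop. *)
Lemma noetherian_prime (F : fieldType) (A I : F -> Prop) : is_subring A -> noetherian A ->
  is_ideal A I -> ~ I 1 -> exists2 P, is_prime_ideal A P & incl I P.
Proof.
move=> hA noeth hI I1; apply: NNPP => hno.
pose Q J := [/\ is_ideal A J, ~ J 1 & incl I J].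
have step J : Q J -> exists2 J', Q J' & strict_subset J J'.
  move=> [hJ J1 IJ]; apply: NNPP => hmax; apply: hno; exists J => //.
  split=> //; split=> // u v Au Av Juv; apply: NNPP => /not_or_and [nu nv].
  have hJ' : is_ideal A (sumI J (dvdr A u)) by apply: sumI_ideal => //; apply: dvdr_ideal.
  have hu := dvdr_ideal hA Au.
  case: (classic (sumI J (dvdr A u) 1)) => [[j [_ [Jj [c Ac ->] e1]]]|n1].
    apply: nv; rewrite -[v]mul1r e1 mulrDl; apply: (idD hJ); first exact: (idMr hJ).
    by rewrite -mulrA; apply: (idM hJ).
  apply: hmax; exists (sumI J (dvdr A u)).
    by split=> // z /IJ; apply: (sumI_l hu).
  split; first by move=> z; apply: (sumI_l hu).
  by move=> /(_ u) h; apply: nu; apply: h; apply: (sumI_r hJ); apply: dvdr_refl.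
have QI : Q I by split=> // z.
have [f [_ Qf Ef]] := dependent_choice QI step.
have [||n hn] := @noetherian_acc _ A f noeth; first by move=> n; case: (Qf n).
  by move=> n; case: (Ef n).
by case: (Ef n) => _; apply; apply: hn.
Qed.

(** Abhyankar's theorem for a family [G] in which a quadratic transform can always be chosen.
    Leaving [G] free lets each application carry its own invariants along the sequence. *)
Lemma quadratic_termination (F : fieldType) (G : (F -> Prop) -> Prop) (D : F -> Prop) z :
  G D -> is_quotient_field D -> (forall R, G R -> regular_local_dim2 R) ->
  (forall R, G R -> exists R' x, [/\ G R', LD R R', nonunits R x &
     forall w, nonunits R w -> dvdr R' x w]) ->
  exists2 R, G R & R z \/ R z^-1.
Proof.
move=> GD hq hG step.
pose E (R R' : F -> Prop) := exists x,
  [/\ LD R R', nonunits R x & forall w, nonunits R w -> dvdr R' x w].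
have [|f [f0 Gf Ef]] := @dependent_choice _ G E D GD.
  by move=> R /step [R' [x [GR' h1 h2 h3]]]; exists R' => //; exists x.
pose e n := proj1_sig (constructive_indefinite_description _ (Ef n)).
have eP n : [/\ LD (f n) (f n.+1), nonunits (f n) (e n) &
    forall w, nonunits (f n) w -> dvdr (f n.+1) (e n) w].
  exact: (proj2_sig (constructive_indefinite_description _ (Ef n))).
have [|||||n hn] := @quadratic_sequence _ f e z; last by exists (f n).
- by move=> n; apply: hG.
- by move=> n; case: (eP n).
- by move=> n; case: (eP n).
- by move=> n; case: (eP n).
- by rewrite f0.
Qed.

(** * Regular rings inside a valuation ring *)

Section Uniformization.
Variables (F : fieldType) (V : F -> Prop).
Hypothesis hV : is_valuation_ring V.
Implicit Types (D R S : F -> Prop).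

(** Here [V] is the order valuation ring, so the given elements have a common denominator [q] in
    [D[t]] outside the extended maximal ideal. It suffices to localize [D[t]] at a prime that
    contains [x], avoids [q], and is larger than that ideal. *)
Lemma order_uniformization D x y (s : seq F) : reg D x y -> is_quotient_field D -> LD D V ->
  incl (gauss_ext D (y / x)) V -> (forall w, w \in s -> V w) ->
  exists R, [/\ regular_local_dim2 R, incl D R, incl R V & forall w, w \in s -> R w].
Proof.
move=> hreg hq [hVl [DV dom]] BV sV; have [hl noeth hm _ _] := hreg.
have hD := local_sub hl; have hVs := local_sub hVl.
pose t := y / x; pose A := adj D t.
have hA : is_subring A by apply: adj_subring.
have At : A t by apply: adj_gen.
have ht : rtrans D t := order_rtrans hreg hq.
have hP := adjm_prime hl ht; have [hPI [_ pP]] := hP.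
have nx := maxgenl hD hm; have Dx := nonunits_sub nx.
have nVx : ~ V x^-1.
  by move=> h; apply: (nonunits_inv (reg_neq0 hreg) h); apply/dom.
have [q [[q' hq' eq] nq sq]] : exists q,
    [/\ A q, ~ adj (nonunits D) t q & forall w, w \in s -> A (w * q)].
  elim: s sV => [|w s IH] sV.
    by exists 1; split=> //; [rin|case: hP => _ []].
  have [|q [Aq nq sq]] := IH; first by move=> v vs; apply: sV; rewrite inE vs orbT.
  have [|[p [r [Ap Ar nr ew]]] _] := order_maximal hreg hq hVs BV nVx (w := w).
    by apply: sV; rewrite inE eqxx.
  have r0 := prime_neq0 hP nr.
  exists (r * q); split; rin; first by move=> /(pP _ _ Ar Aq) [].
  move=> v; rewrite inE => /orP [/eqP ->|vs]; last by have ? := sq v vs; rewrite mulrCA; rin.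
  by rewrite ew mulrA divfK //; rin.
have Aq : A q by exists q'.
(* Euclid's trick: a prime containing [g.[t] = 1 + t q] cannot contain [q]. The factor ['X] ensures
   that [g] is not constant modulo the maximal ideal, so that [x] and [g.[t]] generate a proper
   ideal. *)
pose g : {poly F} := 1%:P + 'X * q'.
have hg : polyin D g.
  apply: polyinD => //; first by apply: polyinC; rin.
  by apply: polyinM => //; apply: polyinX.
have eg : g.[t] = 1 + t * q by rewrite /g hornerD hornerM hornerC hornerX eq.
have nq' : ~ polyin (nonunits D) q' by move=> h; apply: nq; rewrite eq; exists q'.
have [j nqj jmax] := top_unit_coef hD nq'.
have cg k : g`_k.+1 = q'`_k by rewrite /g coefD coefC coefXM add0r.
have ngj : ~ nonunits D g`_j.+1 by rewrite cg.
have gmax k : (j.+1 < k)%N -> nonunits D g`_k by case: k => // k lt; rewrite cg; apply: jmax.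
have Ag : A g.[t] by exists g.
have Ax : A x by apply: adj_sub.
pose I := sumI (dvdr A x) (dvdr A g.[t]).
have hx := dvdr_ideal hA Ax; have hgi := dvdr_ideal hA Ag.
have hI : is_ideal A I by apply: sumI_ideal.
have nI : ~ I 1.
  move=> [_ [_ [[c Ac ->] [_ [h hh ->] ->] e1]]].
  have hhg : polyin D (h * g - 1%:P).
    apply: polyinD => //; first exact: polyinM.
    by apply: polyinN => //; apply: polyinC; rin.
  have hmm : polyin (nonunits D) (h * g - 1%:P).
    apply: (rtrans_coef hl ht hhg).
    have -> : (h * g - 1%:P).[t] = (- c) * x.
      by rewrite hornerD hornerN hornerM hornerC e1; ring.
    apply: (idM hPI); first by rin.
    exists x%:P; rewrite ?hornerC // => i; rewrite coefC.
    by case: eqP => _ //; exact: nonunits0.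
  have nh : ~ polyin (nonunits D) h.
    move=> nh; apply: (nonunits1 hD).
    have -> : 1 = (h * g)`_0 - (h * g - 1%:P)`_0 :> F by rewrite coefB coefC eqxx; ring.
    apply: (idB hD (local_id hl)) => //.
    by rewrite mulrC; apply: (polyin_idM (local_id hl)).
  have [i nhi imax] := top_unit_coef hD nh.
  (* [h * g] is congruent to 1, while its last unit coefficient has index [i + j.+1], which is
     positive. *)
  apply: (gauss_top hl hh hg nhi imax ngj gmax).
  have := hmm (i + j.+1)%N; by rewrite coefB coefC addnS subr0.
have [P hPr IP] := noetherian_prime hA (adj_noetherian (t := t) hD noeth) hI nI.
have [hPI' [P1 _]] := hPr.
have Px : P x by apply: IP; apply: (sumI_l hgi); apply: dvdr_refl.
have Pg : P g.[t] by apply: IP; apply: (sumI_r hx); apply: dvdr_refl.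
have sub := adjm_sub_prime hreg hPr Px.
have nPq : ~ P q.
  move=> Pq; apply: P1; have -> : 1 = g.[t] - t * q by rewrite eg; ring.
  by apply: (idB hA hPI') => //; apply: (idM hPI').
exists (locat A P); split.
- apply: (quadratic_transform_regular hreg hq hPr Px); exists g; split=> //.
- by move=> w Dw; apply: locat_sub => //; apply: adj_sub.
- move=> w [p [r [Ap Ar nr ew]]]; apply: BV; exists p, r; split=> // h; apply: nr.
  exact: sub.
- move=> w /sq Aw; exists (w * q), q; split=> //; rewrite mulfK //.
  exact: prime_neq0 hPr nPq.
Qed.

Lemma valuation_uniformization D (s : seq F) : regular_local_dim2 D -> is_quotient_field D ->
  LD D V -> (forall w, w \in s -> V w) ->
  exists R, [/\ regular_local_dim2 R, incl D R, incl R V & forall w, w \in s -> R w].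
Proof.
move=> hDr hq hLD sV; pose G R := [/\ regular_local_dim2 R, incl D R & LD R V].
have qG R : G R -> is_quotient_field R by move=> [_ DR _]; apply: quotient_field_incl hq.
(* Either some regular ring dominated by [V] has its order valuation ring inside [V], or
   [quadratic_step] can be repeated without end, and the elements of [s] are captured one at a
   time. *)
case: (classic (exists R x y, [/\ G R, reg R x y & incl (gauss_ext R (y / x)) V])).
  move=> [R [x [y [GR hreg BV]]]]; have [_ DR RV] := GR.
  have [R' [h1 h2 h3 h4]] := order_uniformization hreg (qG R GR) RV BV sV.
  by exists R'; split=> // w /DR /h2.
move=> hno; suff [R [[h1 h2 [_ [h3 _]]] h4]] : exists R, G R /\ forall w, w \in s -> R w.
  by exists R.
elim: s sV => [|w s IH] sV; first by exists D; split=> //; split.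
have [|R0 [GR0 sR0]] := IH; first by move=> v vs; apply: sV; rewrite inE vs orbT.
have step R : G R -> exists R' x, [/\ G R' , LD R R', nonunits R x &
    forall w, nonunits R w -> dvdr R' x w].
  move=> GR; have [hR DR RV] := GR.
  have [x [y [hm Vt]]] : exists x y, maxgen R x y /\ V (y / x).
    have [x [y hm]] := rlr_maxgen hR; have hreg := rlr_reg hR hm.
    have t0 : y / x != 0.
      by rewrite mulf_neq0 ?invr_neq0 ?(reg_neq0 hreg) ?(reg_neq0 (regC hreg)).
    have [_ /(_ _ t0) [h|]] := hV; first by exists x, y.
    by rewrite invf_div => h; exists y, x; split=> //; apply: maxgenC.
  have hreg := rlr_reg hR hm; have [hl _] := hR.
  case: (quadratic_step hreg (qG R GR) RV Vt) => [BV|[R' [f [h1 h2 h3 h4 _]]]].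
    by case: hno; exists R, x, y.
  exists R', x; split=> //; last exact: (maxgenl (local_sub hl) hm).
  by split=> // v /DR; case: h2 => _ [h _]; apply: h.
pose H R := G R /\ incl R0 R.
have [|||R [GR R0R] Rw] := @quadratic_termination _ H R0 w _ (qG R0 GR0).
- by split.
- by move=> R [[]].
- move=> R [/step [R' [x [GR' h1 h2 h3]]] R0R]; exists R', x; split=> //; split=> //.
  by move=> v /R0R; case: h1 => _ [h _]; apply: h.
exists R; split=> // v; rewrite inE => /orP [/eqP ->|/sR0 /R0R //].
have [[hl _] _ [_ [RV dom]]] := GR.
(* If [w^-1] is in [R], it is a unit there: [V] dominates [R] and contains [w]. *)
case: Rw => // Rw'; have Vw : V w by apply: sV; rewrite inE eqxx.
case: (eqVneq w 0) => [->|w0]; first exact: (sr0 (local_sub hl)).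
rewrite -[w]invrK; have [] // := unit_inv Rw'.
by move=> /(dom _ Rw'); apply: nonunits_inv; rewrite ?invr_eq0 // invrK.
Qed.

End Uniformization.

(** * Patch limit points are valuation rings *)

Section LimitPoints.
Variables (F : fieldType) (R : F -> Prop).
Implicit Types (D S : F -> Prop).

(** Limit points tested by finite lists of required and forbidden elements. [D] enters only through
    [QD], so the property can pass to a quadratic transform of [D]. *)
Definition limit_point D : Prop := forall s u : seq F,
  (forall w, w \in s -> R w) -> (forall w, w \in u -> ~ R w) ->
  exists S, [/\ QD D S, ~ same_ring S R, forall w, w \in s -> S w & forall w, w \in u -> ~ S w].

Lemma patch_limit_point_nbhd D : patch_limit_point D (QD D) R -> limit_point D.
Proof.
move=> [hLD hlim] s u sR uR.
(* Each forbidden element needs its own [Vset]: the [Vset] of a longer list only says that some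
   element is missing. *)
pose W i := if i is k.+1 then Vset D [:: nth 0 u k] else Uset D s.
have [||S [QS [hS [nS WS]]]] := hlim (size u).+1 W.
- move=> [|k] _; first by exists s; left.
  by exists [:: nth 0 u k]; right.
- move=> [|k] lt; first by split.
  split=> // -[_ /(_ (nth 0 u k))]; rewrite inE eqxx => /(_ isT).
  by apply: uR; apply: mem_nth.
exists S; split=> //; first by case: (WS 0%N isT).
move=> w wu Sw; have := WS (index w u).+1; rewrite ltnS index_mem => /(_ wu) [_]; apply.
by split=> // v; rewrite inE nth_index // => /eqP ->.
Qed.

Lemma limit_point_quotient D x y : reg D x y -> is_quotient_field D -> LD D R ->
  limit_point D -> R (y / x) \/ R (x / y).
Proof.
move=> hreg hq [_ [DR _]] hlim; apply: NNPP => /not_or_and [n1 n2].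
(* [r] separates [R] from [D] when [R] is larger. A ring [S] of the family that avoids both
   quotients equals [D]; containing [r], it would then equal [R]. *)
have [r [Rr hr]] : exists r, R r /\ (D r -> incl R D).
  case: (classic (incl R D)) => [h|/not_incl [r Rr nr]]; last by exists r.
  by have [hl _ _ _ _] := hreg; exists 0; split=> //; apply/DR/(sr0 (local_sub hl)).
have [||S [QS nS sS uS]] := hlim [:: r] [:: y / x; x / y].
- by move=> w; rewrite inE => /eqP ->.
- by move=> w; rewrite !inE => /orP [] /eqP ->.
have SD : incl S D.
  by apply: (QD_eq hreg hq QS); apply: uS; rewrite !inE eqxx ?orbT.
have [_ DS] := QS.
apply: nS => w; split=> [/SD /DR //|Rw]; apply: DS; apply: hr => //.
by apply: SD; apply: sS; rewrite inE eqxx.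
Qed.

(** If [R] were not a valuation ring, it could not contain an order valuation ring, so the
    transforms inside [R] would continue forever; but then Abhyankar's theorem gives [z] or [z^-1]
    in [R] for every [z]. *)
Lemma limit_point_valuation D : regular_local_dim2 D -> is_quotient_field D -> LD D R ->
  limit_point D -> is_valuation_ring R.
Proof.
move=> hD hq hLD hlim; apply: NNPP => nv; have hR := local_sub (proj1 hLD).
pose G S := [/\ regular_local_dim2 S, is_quotient_field S, LD S R & limit_point S].
have step S : G S -> exists S' x, [/\ G S', LD S S', nonunits S x &
    forall w, nonunits S w -> dvdr S' x w].
  move=> [hS qS SR limS].
  have [x [y [hm Rt]]] : exists x y, maxgen S x y /\ R (y / x).
    have [x [y hm]] := rlr_maxgen hS.
    case: (limit_point_quotient (rlr_reg hS hm) qS SR limS) => h; first by exists x, y.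
    by exists y, x; split=> //; apply: maxgenC.
  have hreg := rlr_reg hS hm; have [hl _] := hS.
  case: (quadratic_step hreg qS SR Rt) => [BR|[S' [f [h1 h2 h3 h4 [nf hf]]]]].
    by case: nv; apply: order_overring_valuation BR.
  exists S', x; split=> //; last exact: (maxgenl (local_sub hl) hm).
  have [_ [SS' _]] := h2; split=> //; first exact: quotient_field_incl qS.
  (* Adding [y / x] and [f^-1] to the conditions forces the approximating ring [T] to contain the
     transform [S']. *)
  move=> s u sR uR; have [||T [QT nT sT uT]] := limS (y / x :: s) (f^-1 :: u).
  - by move=> w; rewrite inE => /orP [/eqP ->|/sR].
  - by move=> w; rewrite inE => /orP [/eqP ->|/uR].
  exists T; split=> //.
  - split; first by case: QT.
    apply: hf; first exact: (QD_LD hreg).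
      by apply: sT; rewrite inE eqxx.
    by apply: uT; rewrite inE eqxx.
  - by move=> w ws; apply: sT; rewrite inE ws orbT.
  - by move=> w wu; apply: uT; rewrite inE wu orbT.
apply: nv; split=> // z z0.
have GD : G D by [].
have hG S : G S -> regular_local_dim2 S by case.
have [S [_ _ [_ [SR _]] _] hz] := quadratic_termination z GD hq hG step.
by case: hz => /SR h; [left|right].
Qed.

End LimitPoints.

Lemma same_ring_eq (F : fieldType) (R S : F -> Prop) : same_ring R S -> R = S.
Proof. by move=> h; apply: functional_extensionality => w; apply: propositional_extensionality. Qed.

(** Rings inside [V] inherit every [Vset] condition from [V], so only the finitely many elements
    named by the [Uset] conditions have to be captured. *)
Lemma patch_nbhd_finite (F : fieldType) (D V : F -> Prop) n (W : nat -> (F -> Prop) -> Prop) :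
  (forall i, (i < n)%N -> patch_subbasic D (W i)) -> (forall i, (i < n)%N -> W i V) ->
  exists2 s : seq F, (forall w, w \in s -> V w) & forall R, LD D R -> incl R V ->
    (forall w, w \in s -> R w) -> forall i, (i < n)%N -> W i R.
Proof.
elim: n => [|n IH] hW WV; first by exists [::].
have [||s sV hs] := IH; first by move=> i lt; apply/hW/ltnW.
  by move=> i lt; apply/WV/ltnW.
have WnV := WV n (ltnSn n).
have split_last (R : F -> Prop) : (forall i, (i < n)%N -> W i R) -> W n R ->
    forall i, (i < n.+1)%N -> W i R.
  by move=> h hn i; rewrite ltnS leq_eqVlt => /orP [/eqP ->|/h].
have [u [hU|hU]] := hW n (ltnSn n).
  have /hU [_ uV] := WnV; exists (u ++ s).
    by move=> w; rewrite mem_cat => /orP [/uV|/sV].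
  move=> R hR RV us; apply: split_last.
    by apply: hs => // w ws; apply: us; rewrite mem_cat ws orbT.
  by apply/hU; split=> // w wu; apply: us; rewrite mem_cat wu.
have /hU [VL nU] := WnV; exists s => // R hR RV us; apply: split_last; first exact: hs.
by apply/hU; split=> // -[_ uR]; apply: nU; split=> // w /uR /RV.
Qed.

Theorem theorem4p8 (F : fieldType) (D : F -> Prop) :
  is_subring D -> is_quotient_field D -> regular_local_dim2 D ->
  (forall R, patch_limit_point D (QD D) R <-> (LD D R /\ is_valuation_ring R)) /\
  (forall R, patch_closure D (QD D) R <-> QstarD D R).
Proof.
move=> _ hq hD; have [x [y hm]] := rlr_maxgen hD; have hreg := rlr_reg hD hm.
have lim_val R : patch_limit_point D (QD D) R <-> LD D R /\ is_valuation_ring R.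
  split=> [hlim|[hLD hV]].
    split; first by case: hlim.
    by apply: (limit_point_valuation hD hq); [case: hlim|apply: patch_limit_point_nbhd].
  split=> // n W hW WR; have [s sR hs] := patch_nbhd_finite hW WR.
  have [S [hS DS SR sS]] := valuation_uniformization hV hD hq hLD sR.
  have QS : QD D S by [].
  have LS := QD_LD hreg hq QS.
  exists S; split=> //; split=> //; split; last exact: hs.
  move=> /same_ring_eq e; have [x' [y' hm']] := rlr_maxgen hS.
  by apply: (reg_not_valuation (rlr_reg hS hm')); rewrite e.
split=> // R; split=> [[hLD hcl]|[QR|/lim_val [hLD hlim]]].
(* A closure point outside [QD D] is a limit point, because any approximating ring of [QD D] differs
   from it. *)
- case: (classic (QD D R)) => QR; [by left|right]; apply/lim_val; split=> // n W hW WR.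
  have [S [QS [hS WS]]] := hcl n W hW WR; exists S; split=> //; split=> //; split=> //.
  by move=> /same_ring_eq e; apply: QR; rewrite -e.
- by have hLD := QD_LD hreg hq QR; split=> // n W _ WR; exists R.
- split=> // n W hW WR; have [S [QS [hS [_ WS]]]] := hlim n W hW WR.
  by exists S.
Qed.
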